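(* Let $c:\mathbb{R}^n\to\mathbb{R}^m$ be $\mathcal{C}^2$, let $g:\mathbb{R}^m\to\mathbb{R}\cup\{+\infty\}$ be proper and lower semicontinuous, and let $F=g\circ c$. Let $\bar x\in\mathbb{R}^n$ be a point which is qualified relative to the decomposition $(g,c)$ of $F$ and a manifold $\mathcal{M}^g\subset\mathbb{R}^m$ (see context), and let $\mathcal{M}$ be the submanifold of $\mathbb{R}^n$ defined near $\bar x$ by $\mathcal{M}=c^{-1}(\mathcal{M}^g)$. Then there exist a neighborhood $\mathcal{N}_{\bar x}$ of $\bar x$, a constant $\Gamma>0$ and positive constants $c_{\mathrm{ri}},c_{\mathrm{map}},\tilde L$ such that, for all $x\in\mathcal{N}_{\bar x}$, $$\mathbf{prox}_{\gamma g}(c(x))\in\mathcal{M}^g\quad\text{for all }\gamma>0\text{ with }\gamma\in[\varphi(\mathrm{dist}_{\mathcal{M}}(x)),\Gamma],$$ where $\mathrm{dist}_{\mathcal{M}}(x)$ is the distance from $x$ to $\mathcal{M}$ and $$\varphi(t)=\frac{c_{\mathrm{ri}}}{2\tilde L}\left(1-\sqrt{1-\frac{4\tilde L c_{\mathrm{map}}t}{c_{\mathrm{ri}}^2}}\right)=\frac{c_{\mathrm{map}}}{c_{\mathrm{ri}}}t+\frac{\tilde L c_{\mathrm{map}}^2}{c_{\mathrm{ri}}^3}t^2+o(t^2),$$ $\mathcal{N}_{\bar x}$ being small enough that the square root is well defined at $t=\mathrm{dist}_{\mathcal M}(x)$ for $x\in\mathcal{N}_{\bar x}$. In particular, there exist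 $L>0$ and $\epsilon>0$ such that, for all $x\in\mathbb{R}^n$ and $\gamma>0$, $$\|x-\bar x\|\le\epsilon\ \text{ and }\ L\|x-\bar x\|\le\gamma\le\Gamma\ \Longrightarrow\ \mathbf{prox}_{\gamma g}(c(x))\in\mathcal{M}^g.$$
   Context: $\partial g$ denotes the general (limiting) subdifferential, and $\widehat\partial g$ the regular (Fréchet) subdifferential; $g$ is (Clarke) regular at $y$ if these coincide there in the sense of Rockafellar–Wets, ''Variational Analysis''. The proximity operator is, for $\gamma>0$, $\mathbf{prox}_{\gamma g}(y)=\operatorname{argmin}_{u\in\mathbb{R}^m}\{g(u)+\frac1{2\gamma}\|u-y\|^2\}$ (the membership in the theorem means in particular that it is single-valued there, with its unique value in $\mathcal{M}^g$). Manifolds. $\mathcal{M}$ is a $\mathcal{C}^2$-submanifold of $\mathbb{R}^N$ around $\bar z\in\mathcal{M}$ if there is a $\mathcal{C}^2$ map $h:\mathbb{R}^N\to\mathbb{R}^{N-p}$ with surjective derivative at $\bar z$ such that, for $z$ near $\bar z$, $z\in\mathcal{M}\Leftrightarrow h(z)=0$. Tangent and normal spaces: $T_z\mathcal{M}=\ker \mathrm{D}h(z)$, $N_z\mathcal{M}=\operatorname{Im}\mathrm{D}h(z)^*$. All statements about a manifold are local: it is understood to be replaced by its intersection with a small neighborhood of the reference point, where it is a submanifold. $\mathrm{proj}$ denotes orthogonal projection and $\mathrm{ri}$ relative interior. Prox-regularity. $g$ is prox-regular at $\bar y$ for $\bar v\in\partial g(\bar y)$ if $g$ is finite and locally lower semicontinuous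 at $\bar y$ and there are $r>0,\epsilon>0$ such that $g(y')\ge g(y)+\langle v,y'-y\rangle-\frac r2\|y'-y\|^2$ whenever $v\in\partial g(y)$, $\|y-\bar y\|<\epsilon$, $\|y'-\bar y\|<\epsilon$, $\|v-\bar v\|<\epsilon$, $g(y)<g(\bar y)+\epsilon$; it is prox-regular at $\bar y$ if this holds for every $\bar v\in\partial g(\bar y)$. $g$ is prox-bounded if $g+\frac R2\|\cdot\|^2$ is bounded below for some $R\ge0$. Partial smoothness. $g$ is ($\mathcal{C}^2$-)partly smooth at $\bar y$ relative to a set $\mathcal{M}^g\ni\bar y$ if $\mathcal{M}^g$ is a $\mathcal{C}^2$ manifold around $\bar y$ and: (smoothness) $g|_{\mathcal{M}^g}$ is $\mathcal{C}^2$ near $\bar y$; (regularity) $g$ is Clarke regular at all $y\in\mathcal{M}^g$ near $\bar y$, with $\partial g(y)\ne\emptyset$; (sharpness) the affine span of $\partial g(\bar y)$ is a translate of $N_{\bar y}\mathcal{M}^g$; (sub-continuity) the set-valued map $\partial g$ restricted to $\mathcal{M}^g$ is continuous at $\bar y$. For $p\in\mathcal{M}^g$ near $\bar y$, $\operatorname{grad}g(p)=\mathrm{proj}_{T_p\mathcal{M}^g}(\partial g(p))$ denotes the Riemannian gradient (a single vector). Normal ascent property at $\bar y$: $0\in\mathrm{ri}\,\mathrm{proj}_{N_{\bar y}\mathcal{M}^g}\partial g(\bar y)$. Curve property at $\bar y$ (for $g$ partly smooth at $\bar y$ relative to $\mathcal{M}^g$): there exist a neighborhood $\mathcal{N}_{\bar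 y}$ of $\bar y$ and $T>0$ such that for any smooth (continuously differentiable) map $e:\mathcal{N}_{\bar y}\times[0,T]\to\mathcal{M}^g$ with $e(y,0)=\mathrm{proj}_{\mathcal{M}^g}(y)$ and $\frac{\mathrm d}{\mathrm dt}e(y,t)|_{t=0}=-\operatorname{grad}g(\mathrm{proj}_{\mathcal{M}^g}(y))$ for all $y\in\mathcal{N}_{\bar y}$, there is a constant $\tilde L>0$ with $\|\mathrm{proj}_{N_{e(y,t)}\mathcal{M}^g}(e(y,t)-y)\|\le\mathrm{dist}_{\mathcal{M}^g}(y)+\tilde L t^2$ for all $y\in\mathcal{N}_{\bar y}$, $t\in[0,T]$, where $\mathrm{dist}_{\mathcal{M}^g}(y)=\|y-\mathrm{proj}_{\mathcal{M}^g}(y)\|$. Transversality. $c$ is transversal to $\mathcal{M}^g$ at $\bar x$ if $\mathcal{M}^g$ is a manifold around $c(\bar x)$ and $N_{c(\bar x)}\mathcal{M}^g\cap\ker(\mathrm{D}c(\bar x)^* )=\{0\}$. In that case $c^{-1}(\mathcal{M}^g)$ is a submanifold of $\mathbb{R}^n$ near $\bar x$. Qualified point. $\bar x\in\mathbb{R}^n$ is qualified relative to the decomposition $(g,c)$ of $F$ and the manifold $\mathcal{M}^g$ if: (1) $g$ is prox-bounded and prox-regular at $c(\bar x)$; (2) $g$ is partly smooth at $c(\bar x)$ relative to $\mathcal{M}^g$; (3) $c$ is transversal to $\mathcal{M}^g$ at $\bar x$; (4) $g$ satisfies the normal ascent property and the curve property at $c(\bar x)$. *)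

(* Defs.v *)
From HB Require Import structures.
From mathcomp Require Import all_boot all_order all_algebra.
From mathcomp Require Import all_classical all_reals all_analysis.

Set Implicit Arguments.
Unset Strict Implicit.
Unset Printing Implicit Defensive.

Import Order.TTheory GRing.Theory Num.Theory.
Import numFieldNormedType.Exports.

Local Open Scope classical_set_scope.
Local Open Scope ring_scope.

(* Euclidean structure. The library's norm on ['rV[R]_n] is the sup norm: it *)
(* has the right topology, but is never used below where a length is meant. *)

Definition dot (R : realType) (n : nat) (u v : 'rV[R]_n) : R :=
  \sum_(i < n) u 0 i * v 0 i.

Definition enorm (R : realType) (n : nat) (u : 'rV[R]_n) : R :=
  Num.sqrt (dot u u).

Definition nearest (R : realType) (n : nat) (A : set 'rV[R]_n)
    (y : 'rV[R]_n) : set 'rV[R]_n :=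
  [set p | A p /\ forall q, A q -> enorm (y - p) <= enorm (y - q)].

(* Meaningful when [nearest A y] is a singleton; for [A] a linear subspace *)
(* this is the orthogonal projection. *)
Definition proj_on (R : realType) (n : nat) (A : set 'rV[R]_n)
    (y : 'rV[R]_n) : 'rV[R]_n := xget 0 (nearest A y).

Definition dist_to (R : realType) (n : nat) (A : set 'rV[R]_n)
    (x : 'rV[R]_n) : R := inf [set enorm (x - z) | z in A].

Definition is_singleton (T : Type) (A : set T) : Prop :=
  exists a, A = [set a].

Definition affine_span (R : realType) (n : nat) (A : set 'rV[R]_n) :
    set 'rV[R]_n :=
  [set y | exists (k : nat) (a : 'I_k -> R) (v : 'I_k -> 'rV[R]_n),
     [/\ forall i, A (v i), \sum_(i < k) a i = 1
       & y = \sum_(i < k) a i *: v i]].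

Definition rel_interior (R : realType) (n : nat) (A : set 'rV[R]_n) :
    set 'rV[R]_n :=
  [set x | A x /\ exists2 e : R, 0 < e &
     forall z, affine_span A z -> enorm (z - x) < e -> A z].

(* C^1 and C^2 on an open set [U]. All spaces used are finite dimensional, so *)
(* continuity of [y |-> 'd f y] in operator norm is pointwise continuity. *)

Definition C1_on (R : realType) (V W : normedModType R) (U : set V)
    (f : V -> W) : Prop :=
  forall x, U x -> differentiable f x /\
    forall v, {for x, continuous (fun y => 'd f y v)}.

Definition C2_on (R : realType) (V W : normedModType R) (U : set V)
    (f : V -> W) : Prop :=
  C1_on U f /\ forall v, C1_on U (fun y => 'd f y v).

(* C^1 on an arbitrary set: restriction of a C^1 map on an open superset. *)
Definition C1_around (R : realType) (V W : normedModType R) (A : set V)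
    (f : V -> W) : Prop :=
  exists U : set V, [/\ open U, A `<=` U & C1_on U f].

Definition adj_diff (R : realType) (n m : nat) (f : 'rV[R]_n -> 'rV[R]_m)
    (x : 'rV[R]_n) (w : 'rV[R]_m) : 'rV[R]_n := w *m ('J f x)^T.

Lemma adj_diffP (R : realType) (n m : nat) (f : 'rV[R]_n -> 'rV[R]_m)
    (x u : 'rV[R]_n) (w : 'rV[R]_m) :
  dot ('d f x u) w = dot u (adj_diff f x w).
Proof.
have dotE k (a b : 'rV[R]_k) : dot a b = (a *m b^T) 0 0.
  by rewrite /dot mxE; apply: eq_bigr => i _; rewrite mxE.
by rewrite !dotE /adj_diff trmx_mul trmxK mulmxA /jacobian mul_rV_lin1.
Qed.

Definition defining_map (R : realType) (N k : nat) (M : set 'rV[R]_N)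
    (z : 'rV[R]_N) (h : 'rV[R]_N -> 'rV[R]_k) : Prop :=
  [/\ C2_on setT h, forall w, exists v, 'd h z v = w
    & \forall z' \near z, M z' <-> h z' = 0].

Definition submanifold_at (R : realType) (N : nat) (M : set 'rV[R]_N)
    (z : 'rV[R]_N) : Prop :=
  M z /\ exists (k : nat) (h : 'rV[R]_N -> 'rV[R]_k), defining_map M z h.

(* At a point where [M] is a submanifold these sets do not depend on [h], and *)
(* a defining map at [z] is also one at the points of [M] near [z]. *)
Definition tangent_space (R : realType) (N : nat) (M : set 'rV[R]_N)
    (z : 'rV[R]_N) : set 'rV[R]_N :=
  [set v | exists (k : nat) (h : 'rV[R]_N -> 'rV[R]_k),
     defining_map M z h /\ 'd h z v = 0].

Definition normal_space (R : realType) (N : nat) (M : set 'rV[R]_N)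
    (z : 'rV[R]_N) : set 'rV[R]_N :=
  [set v | exists (k : nat) (h : 'rV[R]_N -> 'rV[R]_k),
     defining_map M z h /\ exists w, v = adj_diff h z w].

Definition proper_efun (R : realType) (m : nat) (g : 'rV[R]_m -> \bar R) :
    Prop :=
  (forall y, g y != -oo%E) /\ exists y, g y != +oo%E.

Definition frechet_subdiff (R : realType) (m : nat) (g : 'rV[R]_m -> \bar R)
    (y : 'rV[R]_m) : set 'rV[R]_m :=
  [set v | g y \is a fin_num /\ forall e : R, 0 < e ->
     \forall y' \near y,
       (g y + (dot v (y' - y) - e * enorm (y' - y))%:E <= g y')%E].

Definition subdiff (R : realType) (m : nat) (g : 'rV[R]_m -> \bar R)
    (y : 'rV[R]_m) : set 'rV[R]_m :=
  [set v | g y \is a fin_num /\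
     exists (ys vs : nat -> 'rV[R]_m),
       [/\ ys @ \oo --> y, (g \o ys) @ \oo --> g y, vs @ \oo --> v
         & forall k, frechet_subdiff g (ys k) (vs k)]].

(* Implied by Clarke regularity of the epigraph of [g] at [(y, g y)]. *)
Definition clarke_regular (R : realType) (m : nat) (g : 'rV[R]_m -> \bar R)
    (y : 'rV[R]_m) : Prop := subdiff g y = frechet_subdiff g y.

Definition locally_lsc (R : realType) (m : nat) (g : 'rV[R]_m -> \bar R)
    (ybar : 'rV[R]_m) : Prop :=
  exists2 e : R, 0 < e & forall a : \bar R, (a <= g ybar + e%:E)%E ->
    closed [set y | enorm (y - ybar) <= e /\ (g y <= a)%E].

Definition prox_regular_for (R : realType) (m : nat) (g : 'rV[R]_m -> \bar R)
    (ybar vbar : 'rV[R]_m) : Prop :=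
  [/\ g ybar \is a fin_num, locally_lsc g ybar &
    exists r e : R, [/\ 0 < r, 0 < e & forall y y' v, subdiff g y v ->
      enorm (y - ybar) < e -> enorm (y' - ybar) < e -> enorm (v - vbar) < e ->
      (g y < g ybar + e%:E)%E ->
      (g y + (dot v (y' - y) - r / 2 * enorm (y' - y) ^+ 2)%:E <= g y')%E]].

Definition prox_regular (R : realType) (m : nat) (g : 'rV[R]_m -> \bar R)
    (ybar : 'rV[R]_m) : Prop :=
  forall vbar, subdiff g ybar vbar -> prox_regular_for g ybar vbar.

Definition prox_bounded (R : realType) (m : nat) (g : 'rV[R]_m -> \bar R) :
    Prop :=
  exists2 r : R, 0 <= r & exists b : R,
    forall y, (b%:E <= g y + (r / 2 * enorm y ^+ 2)%:E)%E.

Definition prox (R : realType) (m : nat) (gamma : R) (g : 'rV[R]_m -> \bar R)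
    (y : 'rV[R]_m) : set 'rV[R]_m :=
  [set u | forall w,
    (g u + ((2 * gamma)^-1 * enorm (u - y) ^+ 2)%:E <=
     g w + ((2 * gamma)^-1 * enorm (w - y) ^+ 2)%:E)%E].

Definition prox_in (R : realType) (m : nat) (gamma : R)
    (g : 'rV[R]_m -> \bar R) (y : 'rV[R]_m) (M : set 'rV[R]_m) : Prop :=
  exists2 p, prox gamma g y = [set p] & M p.

(* Painleve-Kuratowski limits of [S] at [x] relative to [X]. *)

Definition outer_limit (R : realType) (m : nat) (X : set 'rV[R]_m)
    (S : 'rV[R]_m -> set 'rV[R]_m) (x : 'rV[R]_m) : set 'rV[R]_m :=
  [set v | exists xs vs : nat -> 'rV[R]_m,
     [/\ forall k, X (xs k), xs @ \oo --> x, forall k, S (xs k) (vs k)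
       & vs @ \oo --> v]].

Definition inner_limit (R : realType) (m : nat) (X : set 'rV[R]_m)
    (S : 'rV[R]_m -> set 'rV[R]_m) (x : 'rV[R]_m) : set 'rV[R]_m :=
  [set v | forall xs : nat -> 'rV[R]_m, (forall k, X (xs k)) ->
     xs @ \oo --> x -> exists2 vs : nat -> 'rV[R]_m,
       (\forall k \near \oo, S (xs k) (vs k)) & vs @ \oo --> v].

Definition set_continuous_within (R : realType) (m : nat) (X : set 'rV[R]_m)
    (S : 'rV[R]_m -> set 'rV[R]_m) (x : 'rV[R]_m) : Prop :=
  outer_limit X S x `<=` S x /\ S x `<=` inner_limit X S x.

(* That [g] restricted to [M] is C^2 near [ybar] means that it has a C^2 *)
(* extension [G] to a neighborhood of [ybar]. *)

Definition C2_restriction (R : realType) (m : nat) (g : 'rV[R]_m -> \bar R)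
    (M : set 'rV[R]_m) (ybar : 'rV[R]_m) : Prop :=
  exists (U : set 'rV[R]_m) (G : 'rV[R]_m -> R),
    [/\ open U, U ybar, C2_on U G
      & forall y, U y -> M y -> g y = (G y)%:E].

Definition sharp (R : realType) (m : nat) (g : 'rV[R]_m -> \bar R)
    (M : set 'rV[R]_m) (ybar : 'rV[R]_m) : Prop :=
  exists a, affine_span (subdiff g ybar) =
            [set a + w | w in normal_space M ybar].

Definition partly_smooth (R : realType) (m : nat) (g : 'rV[R]_m -> \bar R)
    (M : set 'rV[R]_m) (ybar : 'rV[R]_m) : Prop :=
  submanifold_at M ybar /\
  [/\ C2_restriction g M ybar,
      \forall y \near ybar, M y -> clarke_regular g y /\ subdiff g y !=set0,
      sharp g M ybar
    & set_continuous_within M (subdiff g) ybar].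

Definition riem_grads (R : realType) (m : nat) (g : 'rV[R]_m -> \bar R)
    (M : set 'rV[R]_m) (p : 'rV[R]_m) : set 'rV[R]_m :=
  proj_on (tangent_space M p) @` subdiff g p.

Definition riem_grad (R : realType) (m : nat) (g : 'rV[R]_m -> \bar R)
    (M : set 'rV[R]_m) (p : 'rV[R]_m) : 'rV[R]_m := xget 0 (riem_grads g M p).

Definition normal_ascent (R : realType) (m : nat) (g : 'rV[R]_m -> \bar R)
    (M : set 'rV[R]_m) (ybar : 'rV[R]_m) : Prop :=
  rel_interior (proj_on (normal_space M ybar) @` subdiff g ybar) 0.

(* The neighborhood [V] need not be open. The first condition on [V] says that *)
(* the projection and the Riemannian gradient are well defined on it. *)
Definition curve_property_on (R : realType) (m : nat)
    (g : 'rV[R]_m -> \bar R) (M : set 'rV[R]_m) (ybar : 'rV[R]_m) : Prop :=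
  exists (V : set 'rV[R]_m) (T : R),
    [/\ nbhs ybar V, 0 < T,
        forall y, V y -> is_singleton (nearest M y) /\
                         is_singleton (riem_grads g M (proj_on M y))
      & forall e : 'rV[R]_m * R -> 'rV[R]_m,
          C1_around (V `*` [set t : R | 0 <= t <= T]) e ->
          (forall y (t : R), V y -> 0 <= t <= T -> M (e (y, t))) ->
          (forall y, V y -> e (y, 0) = proj_on M y) ->
          (forall y, V y ->
             derive1 (fun t : R => e (y, t)) 0
               = - riem_grad g M (proj_on M y)) ->
          exists2 L : R, 0 < L & forall y (t : R), V y -> 0 <= t <= T ->
            enorm (proj_on (normal_space M (e (y, t))) (e (y, t) - y))
              <= enorm (y - proj_on M y) + L * t ^+ 2].

(* The set [M] is localized to a neighborhood [W] where it is a submanifold. *)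
Definition curve_property (R : realType) (m : nat)
    (g : 'rV[R]_m -> \bar R) (M : set 'rV[R]_m) (ybar : 'rV[R]_m) : Prop :=
  exists W : set 'rV[R]_m,
    [/\ open W, W ybar, forall z, (M `&` W) z -> submanifold_at M z
      & curve_property_on g (M `&` W) ybar].

Definition transversal_to (R : realType) (n m : nat)
    (c : 'rV[R]_n -> 'rV[R]_m) (M : set 'rV[R]_m) (xbar : 'rV[R]_n) : Prop :=
  submanifold_at M (c xbar) /\
  normal_space M (c xbar) `&` [set w | adj_diff c xbar w = 0] = [set 0].

Definition qualified (R : realType) (n m : nat) (g : 'rV[R]_m -> \bar R)
    (c : 'rV[R]_n -> 'rV[R]_m) (M : set 'rV[R]_m) (xbar : 'rV[R]_n) : Prop :=
  [/\ prox_bounded g /\ prox_regular g (c xbar),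
      partly_smooth g M (c xbar),
      transversal_to c M xbar
    & normal_ascent g M (c xbar) /\ curve_property g M (c xbar)].

Definition phi_discr (R : realType) (cri cmap L t : R) : R :=
  1 - 4 * L * cmap * t / cri ^+ 2.

Definition phi (R : realType) (cri cmap L t : R) : R :=
  cri / (2 * L) * (1 - Num.sqrt (phi_discr cri cmap L t)).

(* Main.v *)
(* By regularity and prox-regularity, a point p of M is the proximal point of y *)
(* for a small step gamma as soon as v = (y - p) / gamma behaves like a         *)
(* subgradient at p. Take for p a minimizer of g + |. - y|^2 / (2 gamma) over M *)
(* near ybar: the Lagrange multiplier rule leaves only the component of v       *)
(* normal to M to be controlled, and this component is small as soon as         *)
(* dist(y, M) <= kappa gamma. Normal ascent and sharpness provide, for every    *)
(* sign vector s, a subgradient at ybar whose normal coordinates are delta s;   *)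
(* sub-continuity moves these subgradients to p, where they still surround v.   *)
(* Hence every direction d admits a subgradient w at p with <w, d> >= <v, d>,   *)
(* and the prox-regularity inequalities at these w give the one needed for v.   *)
(* Prox-boundedness excludes far away competitors. Finally                      *)
(* phi(t) >= (c_map / c_ri) t, so that a large ratio c_map / c_ri suffices.     *)

Require Import Defs.
From HB Require Import structures.
From mathcomp Require Import all_boot all_order all_algebra.
From mathcomp Require Import all_classical all_reals all_analysis.
From mathcomp Require Import ring lra.

Set Implicit Arguments.
Unset Strict Implicit.
Unset Printing Implicit Defensive.

Import Order.TTheory GRing.Theory Num.Theory.
Import numFieldNormedType.Exports.

Local Open Scope classical_set_scope.
Local Open Scope ring_scope.

(** Write y0 = c(xbar), M for [Mg], and let h define M near y0, with Jacobian J. The core is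
    [prox_manifold], a statement in the target space: if y is near y0, gamma is small and some q in
    M has |y - q| <= kap * gamma, then the proximal point of y is unique and lies in M.

    The candidate p minimizes G + |. - y|^2 / (2 gamma) over M near y0, where G is a smooth
    extension of g from M ([restricted_minimizer]). Put v = (y - p) / gamma. The multiplier rule
    gives v - grad G(p) = lam J(p)^T, and regularity gives w - grad G(p) = mu J(p)^T for every
    subgradient w at p ([frechet_multiplier]). So w - v is normal to M at p and is measured by mu -
    lam in R^k. In these coordinates, normal ascent and sharpness supply subgradients at y0 at the
    vertices of a cube of half-width dl around 0 ([normal_ascent_ball]); sub-continuity moves them
    to p, while the coordinates of v stay near 0 ([normal_part_small]). Thus for each y' one of the
    2^k vertices w satisfies <w - v, y' - p> >= 0 ([sign_row_dominates]), and its prox-regularity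
    inequality implies the same one for v ([prox_local]). For small gamma the term 1 / (2 gamma)
    dominates the prox-regularity modulus nearby and the prox-boundedness constant far away, so p is
    the strict global minimizer ([prox_singleton]).

    The theorem follows since c is Lipschitz near xbar: points of c^-1(M) near x are mapped to
    points q near c(x), and phi(t) >= (c_map / c_ri) t converts the lower bound on gamma into the
    required proximity. *)

Section EuclideanSpace.
Variable R : realType.

(** * The Euclidean inner product and its comparison with the sup norm *)

Lemma dotE n (u v : 'rV[R]_n) : dot u v = (u *m v^T) 0 0.
Proof. by rewrite /dot mxE; apply: eq_bigr => i _; rewrite mxE. Qed.

Lemma dotC n (u v : 'rV[R]_n) : dot u v = dot v u.
Proof. by apply: eq_bigr => i _; rewrite mulrC. Qed.

Lemma dotDl n (u v w : 'rV[R]_n) : dot (u + v) w = dot u w + dot v w.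
Proof. by rewrite !dotE mulmxDl mxE. Qed.

Lemma dotNl n (u w : 'rV[R]_n) : dot (- u) w = - dot u w.
Proof. by rewrite !dotE mulNmx mxE. Qed.

Lemma dotBl n (u v w : 'rV[R]_n) : dot (u - v) w = dot u w - dot v w.
Proof. by rewrite dotDl dotNl. Qed.

Lemma dotZl n a (u w : 'rV[R]_n) : dot (a *: u) w = a * dot u w.
Proof. by rewrite !dotE -scalemxAl mxE. Qed.

Lemma dotDr n (u v w : 'rV[R]_n) : dot w (u + v) = dot w u + dot w v.
Proof. by rewrite !(dotC w) dotDl. Qed.

Lemma dotNr n (u w : 'rV[R]_n) : dot w (- u) = - dot w u.
Proof. by rewrite !(dotC w) dotNl. Qed.

Lemma dotBr n (u v w : 'rV[R]_n) : dot w (u - v) = dot w u - dot w v.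
Proof. by rewrite dotDr dotNr. Qed.

Lemma dotZr n a (u w : 'rV[R]_n) : dot w (a *: u) = a * dot w u.
Proof. by rewrite !(dotC w) dotZl. Qed.

Lemma dot_mulmx n k (u : 'rV[R]_n) (B : 'M[R]_(n, k)) (w : 'rV[R]_k) :
  dot (u *m B) w = dot u (w *m B^T).
Proof. by rewrite !dotE trmx_mul trmxK mulmxA. Qed.

Lemma dot_ge0 n (u : 'rV[R]_n) : 0 <= dot u u.
Proof. by apply: sumr_ge0 => i _; rewrite -expr2 sqr_ge0. Qed.

Lemma enorm_ge0 n (u : 'rV[R]_n) : 0 <= enorm u.
Proof. exact: sqrtr_ge0. Qed.

Lemma enorm_sqr n (u : 'rV[R]_n) : enorm u ^+ 2 = dot u u.
Proof. by rewrite sqr_sqrtr // dot_ge0. Qed.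

Lemma dot_sqrD n (u v : 'rV[R]_n) :
  dot (u + v) (u + v) = dot u u + 2 * dot u v + dot v v.
Proof. by rewrite !dotDl !dotDr (dotC v u); ring. Qed.

Lemma dot_sqrD_le n (u v : 'rV[R]_n) :
  dot (u + v) (u + v) <= 2 * dot u u + 2 * dot v v.
Proof.
have := dot_ge0 (u - v); rewrite dot_sqrD dotNr dotNl dotNr opprK.
by rewrite dot_sqrD; lra.
Qed.

Lemma rV_coord_le n (u : 'rV[R]_n) i : `|u 0 i| <= `|u|.
Proof.
rewrite [leRHS]/Num.norm /= mx_normrE; apply/bigmax_geP; right => /=.
by exists (0, i).
Qed.

Lemma mx_coord_le m n (B : 'M[R]_(m, n)) i j : `|B i j| <= `|B|.
Proof.
rewrite [leRHS]/Num.norm /= mx_normrE; apply/bigmax_geP; right => /=.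
by exists (i, j).
Qed.

Lemma mx_norm_le m n (B : 'M[R]_(m, n)) (b : R) :
  0 <= b -> (forall i j, `|B i j| <= b) -> `|B| <= b.
Proof.
move=> b0 h; rewrite [leLHS]/Num.norm /= mx_normrE.
by apply/bigmax_leP; split => // -[i j] _; exact: h.
Qed.

Lemma rV_norm_le n (u : 'rV[R]_n) (b : R) :
  0 <= b -> (forall i, `|u 0 i| <= b) -> `|u| <= b.
Proof. by move=> b0 h; apply: mx_norm_le => // i j; rewrite ord1. Qed.

Lemma mulmx_norm_le m k (u : 'rV[R]_m) (B : 'M[R]_(m, k)) :
  `|u *m B| <= m%:R * `|B| * `|u|.
Proof.
apply: rV_norm_le => [|j]; first by rewrite !mulr_ge0.
rewrite mxE (le_trans (ler_norm_sum _ _ _)) //.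
rewrite -mulrA mulr_natl -[m in _ *+ m]card_ord -sumr_const.
apply: ler_sum => i _; rewrite normrM mulrC.
by apply: ler_pM => //; [exact: mx_coord_le | exact: rV_coord_le].
Qed.

Lemma dot_norm_le n (u v : 'rV[R]_n) : `|dot u v| <= n%:R * `|u| * `|v|.
Proof.
rewrite (le_trans (ler_norm_sum _ _ _)) //.
rewrite -mulrA mulr_natl -[n in _ *+ n]card_ord -sumr_const.
apply: ler_sum => i _; rewrite normrM.
by apply: ler_pM => //; exact: rV_coord_le.
Qed.

Lemma norm_le_enorm n (u : 'rV[R]_n) : `|u| <= enorm u.
Proof.
apply: rV_norm_le => [|i]; first exact: enorm_ge0.
rewrite -sqrtr_sqr ler_wsqrtr // expr2 /dot (bigD1 i) //= lerDl.
by apply: sumr_ge0 => j _; rewrite -expr2 sqr_ge0.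
Qed.

(** A crude constant is enough; [n.+1] keeps it positive, hence invertible, in dimension 0 too. *)
Lemma enorm_le_norm n (u : 'rV[R]_n) : enorm u <= n.+1%:R * `|u|.
Proof.
rewrite -(@ler_pXn2r _ 2) ?nnegrE ?enorm_ge0 ?mulr_ge0 // enorm_sqr.
apply: le_trans (ler_norm _) _; apply: le_trans (dot_norm_le _ _) _.
rewrite exprMn -mulrA -expr2; apply: ler_wpM2r; first exact: sqr_ge0.
by rewrite -natrX ler_nat (leq_trans (leqnSn n)) // -mulnn leq_pmulr.
Qed.

Lemma enorm0_eq0 n (u : 'rV[R]_n) : enorm u = 0 -> u = 0.
Proof. by move=> u0; apply/eqP; rewrite -normr_le0 -u0 norm_le_enorm. Qed.

Lemma enormN n (u : 'rV[R]_n) : enorm (- u) = enorm u.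
Proof. by rewrite /enorm dotNl dotNr opprK. Qed.

Lemma enormBC n (u v : 'rV[R]_n) : enorm (u - v) = enorm (v - u).
Proof. by rewrite -enormN opprB. Qed.

Lemma nbhs_rVP n (p : 'rV[R]_n) (A : set 'rV[R]_n) :
  nbhs p A <-> exists2 r : R, 0 < r & forall x, `|x - p| < r -> A x.
Proof.
split=> [/nbhs_ballP[r r0 hr]|[r r0 hr]].
  exists r => // x xr; apply: hr; rewrite -ball_normE /= distrC //.
apply/nbhs_ballP; exists r => // x; rewrite -ball_normE /= distrC.
exact: hr.
Qed.

End EuclideanSpace.

(** * Strict differentiability of C^1 maps *)

Section StrictDifferentiability.
Variable R : realType.

(** Both points vary: this makes the quasi-Newton map of [tangent_curve] a contraction, and it
    compares two points of the manifold in [normal_part_small]. *)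
Definition strict_diff m k (f : 'rV[R]_m -> 'rV[R]_k) (p : 'rV[R]_m)
    (J : 'M[R]_(m, k)) : Prop :=
  forall e : R, 0 < e -> exists2 r : R, 0 < r & forall x x',
    `|x - p| < r -> `|x' - p| < r ->
    `|f x - f x' - (x - x') *m J| <= e * `|x - x'|.

Definition gradient m (f : 'rV[R]_m -> R) (p : 'rV[R]_m) : 'rV[R]_m :=
  \row_i 'd f p (delta_mx 0 i).

Lemma gradientP m (f : 'rV[R]_m -> R) p u : 'd f p u = dot u (gradient f p).
Proof.
rewrite {1}(row_sum_delta u) linear_sum; apply: eq_bigr => i _.
by rewrite linearZ /= mxE.
Qed.

Lemma mean_value_rV m (f : 'rV[R]_m -> R) (x x' : 'rV[R]_m) :
  (forall t : R, 0 <= t <= 1 -> differentiable f (x' + t *: (x - x'))) ->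
  exists2 t : R, 0 <= t <= 1 &
    f x - f x' = 'd f (x' + t *: (x - x')) (x - x').
Proof.
move=> df; pose l (t : R) := x' + t *: (x - x').
have dl t : is_diff t l (fun s : R => s *: (x - x')).
  have -> : (fun s : R => s *: (x - x')) = 0 + (fun s : R => s *: (x - x')).
    by rewrite add0r.
  exact: is_diffD.
have dfl (t : R) : 0 <= t <= 1 ->
    is_derive t 1 (f \o l) ('d f (l t) (x - x')).
  move=> t01; have dft := df _ t01.
  have [dlt dlE] := dl t.
  have dflt : differentiable (f \o l) t by apply: differentiable_comp.
  apply: DeriveDef; first exact/diff_derivable.
  by rewrite deriveE // diff_comp //= dlE scale1r.
have [||t] := @MVT_segment _ (f \o l) (fun t => 'd f (l t) (x - x')) 0 1 ler01.
- by move=> t; rewrite in_itv /= => /andP[t0 t1]; apply: dfl; rewrite !ltW.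
- apply: continuous_in_subspaceT => t; rewrite inE /= in_itv /= => t01.
  have [dflt _] := dfl t t01.
  by apply: differentiable_continuous; apply/derivable1_diffP.
- rewrite in_itv /= => t01; rewrite subr0 mulr1 /l /= scale1r scale0r addr0.
  by rewrite subrKC => ->; exists t.
Qed.

(** The smallest of finitely many radii works; the default 1 covers an empty index type. It serves
    both coordinates and sign vectors. *)
Lemma uniform_radius (I : finType) (P : I -> R -> Prop) :
  (forall i r r', r' <= r -> P i r -> P i r') ->
  (forall i, exists2 r : R, 0 < r & P i r) ->
  exists2 r : R, 0 < r & forall i, P i r.
Proof.
move=> mono /(_ _)/cid2 h.
exists (\big[Num.min/1]_i sval (h i)).
  by apply/bigmin_gtP; split=> // i _; case: (h i).
move=> i; apply: (mono i (sval (h i))); last by case: (h i).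
exact: bigmin_le_cond.
Qed.

Lemma gradient_continuous m (f : 'rV[R]_m -> R) U p : C1_on U f -> U p ->
  forall e : R, 0 < e -> exists2 r : R, 0 < r & forall x, `|x - p| < r ->
    `|gradient f x - gradient f p| <= e.
Proof.
move=> C1 Up e e0.
have [||r r0 hr] := @uniform_radius 'I_m (fun i r => forall x, `|x - p| < r ->
    `|'d f x (delta_mx 0 i) - 'd f p (delta_mx 0 i)| < e).
- by move=> i r r' r'r h x xr'; apply: h; exact: lt_le_trans r'r.
- move=> i; have [_ /(_ (delta_mx 0 i))] := C1 p Up.
  by move=> /cvgrPdistC_lt /(_ e e0) /nbhs_rVP.
exists r => // x /hr xe; apply: rV_norm_le => [|i]; first exact: ltW.
by rewrite !mxE ltW.
Qed.

Lemma C1_gradient m (f : 'rV[R]_m -> R) U p : open U -> C1_on U f -> U p ->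
  forall e : R, 0 < e -> exists2 r : R, 0 < r & forall x x',
    `|x - p| < r -> `|x' - p| < r ->
    `|f x - f x' - dot (x - x') (gradient f p)| <= e * `|x - x'|.
Proof.
move=> oU C1 Up e e0.
(* Absorbs the dimension factor of [dot_norm_le]. *)
have e'0 : 0 < e / m.+1%:R by rewrite divr_gt0.
have [r1 r10 gr] := gradient_continuous C1 Up e'0.
have /nbhs_rVP[r2 r20 Ur] : nbhs p U by exact: open_nbhs_nbhs.
exists (Num.min r1 r2); first by rewrite lt_min r10.
have m1 : Num.min r1 r2 <= r1 by rewrite ge_min lexx.
have m2 : Num.min r1 r2 <= r2 by rewrite ge_min lexx orbT.
move=> x x' xr x'r.
have seg (t : R) : 0 <= t <= 1 -> `|x' + t *: (x - x') - p| < Num.min r1 r2.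
  move=> /andP[t0 t1].
  have -> : x' + t *: (x - x') - p = (1 - t) *: (x' - p) + t *: (x - p).
    by apply/rowP => i; rewrite !mxE; ring.
  rewrite (le_lt_trans (ler_normD _ _)) // !normrZ.
  rewrite (ger0_norm t0) ger0_norm ?subr_ge0 //.
  move: xr x'r; set a := `|x - p|; set b := `|x' - p|; set r := Num.min _ _.
  by move=> ar br; case: (lerP t (1/2)) => ?; nra.
have [t t01 ->] := @mean_value_rV _ f x x' (fun t t01 =>
  (C1 _ (Ur _ (lt_le_trans (seg t t01) m2))).1).
rewrite gradientP -dotBr (le_trans (dot_norm_le _ _)) //.
have := gr _ (lt_le_trans (seg t t01) m1).
set g := `|_ - _|; set d := `|_ - _|; move=> ge.
have d0 : 0 <= d by exact: normr_ge0.
rewrite mulrAC; apply: ler_wpM2r => //.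
apply: le_trans (ler_wpM2l _ ge) _ => //.
rewrite mulrCA ger_pMr // ler_pdivrMr // mul1r ler_nat //.
Qed.

Lemma diff_coord m k (f : 'rV[R]_m -> 'rV[R]_k) j x : differentiable f x ->
  differentiable (fun y => f y 0 j) x /\
  forall u, 'd (fun y => f y 0 j) x u = 'd f x u 0 j.
Proof.
move=> df.
pose c (w : 'rV[R]_k) := w 0 j : R.
have cl : linear c by move=> a u v; rewrite /c !mxE.
pose cL := GRing.isLinear.Build _ _ _ _ c cl.
pose C : {linear 'rV[R]_k -> R} := HB.pack c cL.
have Cc : continuous C by move=> w; exact: coord_continuous.
have dC : differentiable C (f x) by exact: linear_differentiable.
split; first exact: (differentiable_comp df dC).
move=> u; rewrite -[fun y => f y 0 j]/(C \o f) diff_comp //.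
by rewrite -[LHS]/('d C (f x) ('d f x u)) (diff_lin _ Cc).
Qed.

Lemma jacobianE m k (f : 'rV[R]_m -> 'rV[R]_k) x u : 'd f x u = u *m 'J f x.
Proof. by rewrite /jacobian mul_rV_lin1. Qed.

Lemma C1_coord m k (f : 'rV[R]_m -> 'rV[R]_k) U j : C1_on U f ->
  open U -> C1_on U (fun y => f y 0 j).
Proof.
move=> C1 oU x Ux; have [df cf] := C1 x Ux.
split; first exact: (diff_coord j df).1.
move=> v; have cv : {for x, continuous (fun y => 'd f y v 0 j)}.
  apply: (@continuous_comp _ _ _ (fun y => 'd f y v) (fun w => w 0 j)) => //.
  exact: coord_continuous.
(* The differential of a coordinate is the coordinate of the differential only where [f] is
   differentiable, so [y] must also stay in [U]. *)
have /nbhs_rVP[r1 r10 h1] : nbhs x U by exact: open_nbhs_nbhs.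
apply/(cvgrPdistC_lt (FF := nbhs_filter x)) => e e0.
have /cvgrPdistC_lt/(_ e e0)/nbhs_rVP[r2 r20 h2] := cv.
apply/nbhs_rVP; exists (Num.min r1 r2); first by rewrite lt_min r10.
move=> y; rewrite lt_min => /andP[/h1 Uy /h2].
have Ey : 'd (fun z => f z 0 j) y v = 'd f y v 0 j.
  exact: (diff_coord j (C1 y Uy).1).2.
have Ex : 'd (fun z => f z 0 j) x v = 'd f x v 0 j.
  exact: (diff_coord j df).2.
move=> /(le_lt_trans _); apply.
by have -> := congr2 (fun a b : R => `|a - b|) Ey Ex.
Qed.

Lemma gradient_coord m k (f : 'rV[R]_m -> 'rV[R]_k) j x u :
  differentiable f x ->
  dot u (gradient (fun y => f y 0 j) x) = (u *m 'J f x) 0 j.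
Proof. by move=> df; rewrite -gradientP (diff_coord j df).2 jacobianE. Qed.

Lemma C1_strict_diff m k (f : 'rV[R]_m -> 'rV[R]_k) U p :
  open U -> C1_on U f -> U p -> strict_diff f p ('J f p).
Proof.
move=> oU C1 Up e e0.
have [||r r0 hr] := @uniform_radius 'I_k (fun j r => forall x x',
    `|x - p| < r -> `|x' - p| < r ->
    `|f x 0 j - f x' 0 j - ((x - x') *m 'J f p) 0 j| <= e * `|x - x'|).
- by move=> i r r' r'r h x x' xr' xr; apply: h; exact: lt_le_trans r'r.
- move=> j; have [r r0 hr] := C1_gradient oU (C1_coord j C1 oU) Up e0.
  exists r => // x x' xr x'r; rewrite -(gradient_coord j _ (C1 p Up).1).
  exact: hr.
exists r => // x x' xr x'r.
apply: rV_norm_le => [|j]; first by rewrite mulr_ge0 // ltW.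
by rewrite 3!mxE; have := hr j x x' xr x'r; rewrite !mxE.
Qed.

Lemma jacobian_continuous m k (f : 'rV[R]_m -> 'rV[R]_k) U p :
  C1_on U f -> U p ->
  forall e : R, 0 < e -> exists2 r : R, 0 < r & forall x, `|x - p| < r ->
    `|'J f x - 'J f p| <= e.
Proof.
move=> C1 Up e e0.
have [||r r0 hr] := @uniform_radius 'I_m (fun i r => forall x, `|x - p| < r ->
    `|'d f x (delta_mx 0 i) - 'd f p (delta_mx 0 i)| < e).
- by move=> i r r' r'r h x xr'; apply: h; exact: lt_le_trans r'r.
- move=> i; have [_ /(_ (delta_mx 0 i))] := C1 p Up.
  by move=> /cvgrPdistC_lt /(_ e e0) /nbhs_rVP.
exists r => // x /hr xe; apply: mx_norm_le => [|i j]; first exact: ltW.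
rewrite !mxE ltW // (le_lt_trans _ (xe i)) //.
by have := rV_coord_le ('d f x (delta_mx 0 i) - 'd f p (delta_mx 0 i)) j; rewrite !mxE.
Qed.

Lemma lipschitz_min m (f : 'rV[R]_m -> R) (A : set 'rV[R]_m) (L b : R) :
  A !=set0 -> closed A -> (forall x, A x -> `|x| <= b) ->
  (forall x y, A x -> A y -> `|f x - f y| <= L * `|x - y|) ->
  exists2 x, A x & forall y, A y -> f x <= f y.
Proof.
move=> A0 cA bA lip.
have kA : compact A.
  apply: bounded_closed_compact => //; exists b; split; first exact: num_real.
  by move=> M bM x /bA /le_trans; apply; exact: ltW.
have [|x xA mx] := compact_EVT_min A0 kA (f := f).
  apply/subspace_continuousP => x Ax; apply/cvgrPdist_le => e e0.
  rewrite near_withinE; apply/nbhs_rVP.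
  exists (e / (`|L| + 1)); first by rewrite divr_gt0 // ltr_wpDl.
  move=> y; rewrite ltr_pdivlMr ?ltr_wpDl // => yx Ay.
  apply: le_trans (lip _ _ Ax Ay) _; rewrite distrC in yx.
  apply: le_trans (ltW yx); rewrite mulrC; apply: ler_wpM2l => //.
  by rewrite (le_trans (ler_norm _)) // lerDl.
exists x; first by rewrite inE in xA.
by move=> y Ay; apply: mx; rewrite inE.
Qed.

End StrictDifferentiability.

(** * Lagrange multipliers *)

Section LagrangeMultipliers.
Variable R : realType.

(* The residual [h] is minimised over a small ball of corrections [s *m X^T]: *)
(* a nonzero minimum would be halved by the quasi-Newton step [s - h _]. *)
Lemma tangent_curve m k (h : 'rV[R]_m -> 'rV[R]_k) p (J X : 'M[R]_(m, k))
    (d : 'rV[R]_m) :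
  strict_diff h p J -> h p = 0 -> J^T *m X = 1%:M -> d *m J = 0 ->
  forall e : R, 0 < e -> exists2 r : R, 0 < r & forall t : R, 0 < t -> t < r ->
    exists2 x, h x = 0 & `|x - (p + t *: d)| <= e * t.
Proof.
move=> sd hp JX dJ e e0.
pose C : R := k%:R * `|X^T|.
have C0 : 0 <= C by rewrite mulr_ge0.
have XC (s : 'rV[R]_k) : `|s *m X^T| <= C * `|s| by exact: mulmx_norm_le.
have XJ : X^T *m J = 1%:M by rewrite -[J]trmxK -trmx_mul JX trmx1.
pose e1 : R := e / (C + 1).
have e10 : 0 < e1 by rewrite divr_gt0 // ltr_wpDl.
have Ce1 : C * e1 <= e.
  by rewrite /e1 mulrA ler_pdivrMr ?ltr_wpDl // mulrDr mulr1 mulrC lerDl ltW.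
have D0 : 0 < 2 * (1 + `|d| + C * e1).
  by rewrite mulr_gt0 // -addrA ltr_pwDl // addr_ge0 // mulr_ge0 // ltW.
(* Small enough for two purposes: [e2 * C <= 1 / 2] makes [phi] below a contraction, and e2 |d| <=
   e1 / 2 bounds [phi 0]; together they make [phi] preserve the ball of radius [e1 * t]. *)
pose e2 : R := e1 / (2 * (1 + `|d| + C * e1)).
have e20 : 0 < e2 by rewrite divr_gt0.
have e2E : e2 * (1 + `|d| + C * e1) = e1 / 2.
  by rewrite /e2; field; rewrite gt_eqF //; lra.
have d0 : 0 <= `|d| by [].
have e2d : e2 * `|d| <= e1 / 2.
  rewrite -e2E; apply: ler_wpM2l; first exact: ltW.
  have := mulr_ge0 C0 (ltW e10); lra.
have e2C : e2 * C <= 1 / 2.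
  have : e2 * (C * e1) <= e1 / 2.
    by rewrite -e2E; apply: ler_wpM2l; [exact: ltW | lra].
  by rewrite mulrA => ?; rewrite -(ler_pM2r e10); lra.
have [r r0 hr] := sd _ e20.
exists (r / (`|d| + e + 1)); first by rewrite divr_gt0 // ltr_wpDl // addr_ge0 // ltW.
move=> t t0; rewrite ltr_pdivlMr; last by rewrite ltr_wpDl // addr_ge0 // ltW.
move=> tr.
(* Since [d *m J = 0] and [X^T *m J = 1%:M], the linearization of [h (x s)] at [p] is exactly
   [s]. *)
pose x (s : 'rV[R]_k) := p + t *: d + s *m X^T.
pose phi (s : 'rV[R]_k) := s - h (x s).
have near_p (s : 'rV[R]_k) : `|s| <= e1 * t -> `|x s - p| < r.
  move=> se; have -> : x s - p = t *: d + s *m X^T by rewrite /x -(addrA p) [LHS]addrC addKr.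
  rewrite (le_lt_trans (ler_normD _ _)) // normrZ gtr0_norm //.
  have := XC s; have := ler_wpM2l C0 se.
  have := ler_wpM2r (ltW t0) Ce1; rewrite !mulrA; nra.
have contr s s' : `|s| <= e1 * t -> `|s'| <= e1 * t ->
    `|phi s - phi s'| <= 1 / 2 * `|s - s'|.
  move=> /near_p xs /near_p xs'.
  have E : x s - x s' = (s - s') *m X^T.
    by rewrite /x mulmxBl opprD addrACA subrr add0r.
  have := hr _ _ xs xs'; rewrite E -mulmxA XJ mulmx1.
  have -> : phi s - phi s' = - (h (x s) - h (x s') - (s - s')).
    by apply/rowP => i; rewrite !mxE; ring.
  rewrite normrN => /le_trans; apply.
  have := XC (s - s'); have := ler_wpM2r (normr_ge0 (s - s')) e2C.
  by move=> ? /(ler_wpM2l (ltW e20)); rewrite mulrA => /le_trans; apply.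
have et0 : 0 <= e1 * t by rewrite mulr_ge0 // ltW.
have phi0 : `|phi 0| <= e1 / 2 * t.
  have p0 : `|0 : 'rV[R]_k| <= e1 * t by rewrite normr0.
  have pp : `|p - p| < r by rewrite subrr normr0.
  have := hr _ _ (near_p _ p0) pp; rewrite hp subr0.
  have -> : x 0 - p = t *: d by rewrite /x mul0mx addr0 [LHS]addrC addKr.
  rewrite -scalemxAl dJ scaler0 subr0 /phi sub0r normrN normrZ gtr0_norm //.
  by have := ler_wpM2r (ltW t0) e2d; rewrite mulrCA [t * _]mulrC; lra.
have phi_in s : `|s| <= e1 * t -> `|phi s| <= e1 * t.
  move=> se; have := contr s 0 se; rewrite normr0 subr0 => /(_ et0) c0.
  rewrite -[phi s](subrK (phi 0)) (le_trans (ler_normD _ _)) //.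
  by lra.
have [||||s sin smin] := @lipschitz_min R k (fun s => `|h (x s)|)
   [set s | `|s| <= e1 * t] (3 / 2) (e1 * t).
- by exists 0; rewrite /= normr0.
- have -> : [set s : 'rV[R]_k | `|s| <= e1 * t] = closed_ball_ (fun y => `|y|) 0 (e1 * t).
    by apply/seteqP; split => s; rewrite /closed_ball_ /= sub0r normrN.
  exact: closed_closed_ball_.
- by [].
- move=> s s' se se'; apply: le_trans (ler_dist_dist _ _) _.
  have -> : h (x s) - h (x s') = (s - s') - (phi s - phi s').
    by rewrite /phi; apply/rowP => i; rewrite !mxE; ring.
  rewrite (le_trans (ler_normB _ _)) //.
  by have := contr _ _ se se'; lra.
exists (x s).
  apply/eqP; rewrite -normr_le0.
  have le_phi : `|h (x s)| <= `|h (x (phi s))| by exact: smin (phi_in s sin).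
  have phi_le : `|h (x (phi s))| <= 1 / 2 * `|h (x s)|.
    have := contr s (phi s) sin (phi_in s sin).
    have -> : s - phi s = h (x s) by rewrite /phi opprB addrC subrK.
    have -> : phi s - phi (phi s) = h (x (phi s)).
      by rewrite {2}/phi opprB addrC subrK.
    exact.
  move: (le_trans le_phi phi_le); move: (`|h (x s)|) => b; lra.
rewrite /x [X in `|X|]addrC addKr (le_trans (XC s)) //.
apply: le_trans (ler_wpM2l C0 sin) _.
by have := ler_wpM2r (ltW t0) Ce1; rewrite -mulrA.
Qed.

(** Move along the curve of [tangent_curve]: there x - p = t d + z with |z| <= e t, so dividing the
    first-order inequality by t leaves <d, a> up to an error of order e. *)
Lemma tangent_ge0 m k (h : 'rV[R]_m -> 'rV[R]_k) p (J X : 'M[R]_(m, k))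
    (a d : 'rV[R]_m) :
  strict_diff h p J -> h p = 0 -> J^T *m X = 1%:M ->
  (forall e : R, 0 < e -> exists2 r : R, 0 < r & forall x : 'rV[R]_m, `|x - p| < r ->
     h x = 0 -> - (e * `|x - p|) <= dot (x - p) a) ->
  d *m J = 0 -> 0 <= dot d a.
Proof.
move=> sd hp JX ha dJ; rewrite leNgt; apply/negP => neg.
pose c : R := - dot d a; have c0 : 0 < c by rewrite oppr_gt0.
pose A : R := m%:R * `|a|; have A0 : 0 <= A by rewrite mulr_ge0.
have d0 : 0 <= `|d| by [].
have D0 : 0 < 2 * (A + `|d| + 1 + c) by lra.
pose e : R := c / (2 * (A + `|d| + 1 + c)).
have e0 : 0 < e by rewrite divr_gt0.
have eE : e * (A + `|d| + 1 + c) = c / 2 by rewrite /e; field; rewrite gt_eqF //; lra.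
have e1 : e <= 1 by nra.
have [r1 r10 h1] := ha e e0.
have [r2 r20 h2] := tangent_curve sd hp JX dJ e0.
pose t : R := Num.min (r2 / 2) (r1 / (2 * (`|d| + 1))).
have t0 : 0 < t by rewrite lt_min !divr_gt0 // mulr_gt0 // ltr_wpDl.
have tr2 : t < r2.
  have : t <= r2 / 2 by rewrite ge_min lexx.
  by lra.
have tr1 : t * (`|d| + 1) < r1.
  have : t <= r1 / (2 * (`|d| + 1)) by rewrite ge_min lexx orbT.
  by rewrite ler_pdivlMr ?mulr_gt0 ?ltr_wpDl //; nra.
have [x hx xt] := h2 t t0 tr2.
pose z : 'rV[R]_m := x - (p + t *: d).
have xE : x - p = t *: d + z.
  by apply/rowP => i; rewrite !mxE; ring.
have xpt : `|x - p| <= t * (`|d| + e).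
  by rewrite xE (le_trans (ler_normD _ _)) // normrZ gtr0_norm // /z; lra.
have xr1 : `|x - p| < r1.
  apply: le_lt_trans xpt _; apply: le_lt_trans tr1.
  by apply: ler_wpM2l; [exact: ltW | lra].
have := h1 x xr1 hx; rewrite xE dotDl dotZl -xE.
have := le_trans (ler_norm _) (dot_norm_le z a).
rewrite mulrAC -/A => za; have := ler_wpM2l A0 xt.
have := ler_wpM2l (ltW e0) xpt.
have -> : dot d a = - c by rewrite opprK.
rewrite -/z => q1 q2 q3.
have : t * c <= t * (e * (A + `|d| + 1)) by nra.
rewrite ler_pM2l // => q4.
by have ec := mulr_gt0 e0 c0; move: eE q4; rewrite mulrDr; lra.
Qed.

(** Applying [tangent_ge0] to d and -d shows that [a] is orthogonal to the kernel of [J]. For any u,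
    the vector u - u J X^T is in that kernel because X^T J = 1; taking u among the unit vectors
    reads off the multiplier [a *m X]. *)
Lemma lagrange_multiplier m k (h : 'rV[R]_m -> 'rV[R]_k) p (J X : 'M[R]_(m, k))
    (a : 'rV[R]_m) :
  strict_diff h p J -> h p = 0 -> J^T *m X = 1%:M ->
  (forall e : R, 0 < e -> exists2 r : R, 0 < r & forall x : 'rV[R]_m, `|x - p| < r ->
     h x = 0 -> - (e * `|x - p|) <= dot (x - p) a) ->
  a = (a *m X) *m J^T.
Proof.
move=> sd hp JX ha.
have XJ : X^T *m J = 1%:M by rewrite -[J]trmxK -trmx_mul JX trmx1.
have ker d : d *m J = 0 -> dot d a = 0.
  move=> dJ; apply/eqP; rewrite eq_le (tangent_ge0 sd hp JX ha dJ) andbT.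
  have := tangent_ge0 sd hp JX ha (d := - d).
  by rewrite mulNmx dJ oppr0 dotNl oppr_ge0; apply.
apply/rowP => i.
have coord (w : 'rV[R]_m) : w 0 i = dot (delta_mx 0 i) w.
  by rewrite dotE -rowE !mxE.
rewrite !coord; apply/eqP; rewrite -subr_eq0 -[X in _ - X]dot_mulmx.
set u := delta_mx 0 i.
have -> : dot (u *m J) (a *m X) = dot (u *m J *m X^T) a.
  by rewrite [RHS]dot_mulmx trmxK.
rewrite -dotBl ker // mulmxBl -[X in _ - X]mulmxA XJ mulmx1 subrr //.
Qed.

End LagrangeMultipliers.

(** * Normal spaces and normal ascent *)

Section PartlySmooth.
Variable R : realType.

Lemma gram_unit m k (A : 'M[R]_(m, k)) :
  (forall w : 'rV[R]_k, exists v : 'rV[R]_m, v *m A = w) ->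
  A^T *m A \in unitmx.
Proof.
move=> surj; rewrite -row_free_unit; apply: inj_row_free => u uG.
have uA : u *m A^T = 0.
  apply: enorm0_eq0; apply/eqP; rewrite -sqrf_eq0 enorm_sqr.
  by rewrite dot_mulmx trmxK -mulmxA uG /dot big1 // => i _; rewrite mxE mulr0.
have [v vA] := surj u.
apply: enorm0_eq0; apply/eqP; rewrite -sqrf_eq0 enorm_sqr.
rewrite -{1}vA dot_mulmx uA /dot big1 // => i _; rewrite mxE mulr0 //.
Qed.

Lemma near1_unit k (B : 'M[R]_k) : k%:R * `|B - 1%:M| <= 1 / 2 -> B \in unitmx.
Proof.
move=> B1; rewrite -row_free_unit; apply: inj_row_free => u uB.
have uE : u = - (u *m (B - 1%:M)) by rewrite mulmxBr uB mulmx1 sub0r opprK.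
apply/eqP; rewrite -normr_le0.
have : `|u| <= 1 / 2 * `|u|.
  rewrite {1}uE normrN; apply: le_trans (mulmx_norm_le _ _) _.
  exact: ler_wpM2r.
by move: (`|u|) => b; lra.
Qed.

(** For invertible A^T A, the Moore-Penrose inverse of A^T: [w *m gram_inverse A] lists the
    coordinates, in the rows of A^T, of the projection of [w] onto their span. *)
Definition gram_inverse m k (A : 'M[R]_(m, k)) : 'M[R]_(m, k) :=
  A *m invmx (A^T *m A).

Lemma gram_inverseP m k (A : 'M[R]_(m, k)) :
  A^T *m A \in unitmx -> A^T *m gram_inverse A = 1%:M.
Proof. by move=> uA; rewrite /gram_inverse mulmxA mulmxV. Qed.

(** The residual is orthogonal to the range, and Pythagoras gives minimality together with the
    uniqueness that evaluates the choice in [proj_on]. *)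
Lemma proj_on_range m k (A : 'M[R]_(m, k)) (w : 'rV[R]_m) :
  A^T *m A \in unitmx ->
  proj_on [set z *m A^T | z in setT] w = w *m gram_inverse A *m A^T.
Proof.
move=> uA; set N := [set _ | _ in _]; set p := w *m gram_inverse A *m A^T.
have orth z : dot (w - p) (z *m A^T) = 0.
  rewrite -dot_mulmx mulmxBl /p -!mulmxA mulVmx // mulmx1 subrr.
  by rewrite /dot big1 // => i _; rewrite mxE mul0r.
have pyth z : dot (w - z *m A^T) (w - z *m A^T) =
    dot (w - p) (w - p) + dot (p - z *m A^T) (p - z *m A^T).
  have -> : w - z *m A^T = (w - p) + (p - z *m A^T) by rewrite addrA subrK.
  by rewrite dot_sqrD {2}/p -mulmxBl orth mulr0 addr0.
have pN : nearest N w p.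
  split; first by exists (w *m gram_inverse A).
  move=> _ [z _ <-]; rewrite /enorm ler_wsqrtr // (pyth z) lerDl; exact: dot_ge0.
apply: xget_unique => // q [[z _ <-] qmin].
apply/eqP; rewrite eq_sym -subr_eq0; apply/eqP/enorm0_eq0/eqP.
rewrite -sqrf_eq0 enorm_sqr eq_le dot_ge0 andbT.
have : enorm (w - z *m A^T) ^+ 2 <= enorm (w - p) ^+ 2.
  by rewrite ler_pXn2r ?nnegrE ?enorm_ge0 //; apply: qmin; case: pN.
by rewrite !enorm_sqr (pyth z); lra.
Qed.

Section DefiningMap.
Variables (m k : nat) (M : set 'rV[R]_m) (y0 : 'rV[R]_m).
Variable h : 'rV[R]_m -> 'rV[R]_k.
Hypothesis hM : defining_map M y0 h.

Local Notation J p := ('J h p).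
Local Notation X := (gram_inverse (J y0)).

Lemma defining_C1 : C1_on setT h. Proof. by have [[]] := hM. Qed.

Lemma defining_gram : (J y0)^T *m J y0 \in unitmx.
Proof.
apply: gram_unit => w; have [_ /(_ w)[v vw] _] := hM; exists v.
by rewrite -jacobianE.
Qed.

Lemma defining_strict p : strict_diff h p (J p).
Proof. by apply: C1_strict_diff openT defining_C1 _. Qed.

Lemma defining_eq : exists2 r : R, 0 < r & forall p : 'rV[R]_m, `|p - y0| < r ->
  (M p <-> h p = 0).
Proof. by have [_ _ /nbhs_rVP] := hM. Qed.

(** By continuity of the Jacobian, the single matrix [X] taken at [y0] can read normal coordinates
    at all nearby points. *)
Lemma jacobian_right_inverse : forall e : R, 0 < e ->
  exists2 r : R, 0 < r & forall p : 'rV[R]_m, `|p - y0| < r ->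
    `|(J p)^T *m X - 1%:M| <= e.
Proof.
move=> e e0.
pose C : R := m%:R * `|X| + 1; have C0 : 0 < C by rewrite ltr_wpDl // mulr_ge0.
have eC : 0 < e / C by rewrite divr_gt0.
have [r r0 hr] := jacobian_continuous defining_C1 (I : setT y0) eC.
exists r => // p /hr pr.
rewrite -(gram_inverseP defining_gram) -mulmxBl -linearB /=.
apply: mx_norm_le => [|i j]; first exact: ltW.
have -> : (((J p - J y0)^T) *m X) i j = (row i ((J p - J y0)^T) *m X) 0 j.
  by rewrite -row_mul [RHS]mxE.
apply: le_trans (rV_coord_le _ _) _; apply: le_trans (mulmx_norm_le _ _) _.
have rowle : `|row i ((J p - J y0)^T)| <= e / C.
  apply: rV_norm_le => [|l]; first exact: ltW.
  by rewrite 2![X in `|X|]mxE; apply: le_trans pr; exact: mx_coord_le.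
apply: le_trans (ler_wpM2l _ rowle) _; first by rewrite mulr_ge0.
rewrite mulrA ler_pdivrMr // mulrC ler_wpM2l //; first exact: ltW.
by rewrite /C lerDl.
Qed.

(** The multiplier rule at all points of [M] in one ball: near [y0] the matrix J(p)^T X is
    invertible, and multiplying [X] by its inverse gives an exact right inverse of J(p)^T. *)
Lemma manifold_multiplier : exists2 r : R, 0 < r &
  forall p a : 'rV[R]_m, `|p - y0| < r -> M p ->
  (forall e : R, 0 < e -> exists2 r : R, 0 < r & forall x : 'rV[R]_m,
     `|x - p| < r -> M x -> - (e * `|x - p|) <= dot (x - p) a) ->
  exists mu, a = mu *m (J p)^T.
Proof.
have [r1 r10 h1] := defining_eq.
have e0 : 0 < 1 / (2 * (k%:R + 1)) :> R by rewrite divr_gt0 // mulr_gt0 // ltr_wpDl.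
have [r2 r20 h2] := jacobian_right_inverse e0.
exists (Num.min r1 r2); first by rewrite lt_min r10.
move=> p a; rewrite lt_min => /andP[pr1 pr2] Mp ha.
have uB : (J p)^T *m X \in unitmx.
  apply: near1_unit; apply: le_trans (ler_wpM2l (ler0n _ k) (h2 p pr2)) _.
  rewrite mulrA mulr1 ler_pdivrMr; last by rewrite mulr_gt0 // ltr_wpDl.
  by lra.
have Xp : (J p)^T *m (X *m invmx ((J p)^T *m X)) = 1%:M.
  by rewrite mulmxA mulmxV.
exists (a *m (X *m invmx ((J p)^T *m X))).
apply: (lagrange_multiplier (defining_strict p) _ Xp); first exact/h1.
move=> e e'0; have [r r0 hr] := ha e e'0.
pose s : R := Num.min r (r1 - `|p - y0|).
exists s; first by rewrite lt_min r0 subr_gt0.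
move=> x; rewrite lt_min => /andP[xr xr1] hx; apply: hr => //; apply/h1 => //.
have -> : x - y0 = (x - p) + (p - y0) by rewrite addrA subrK.
by rewrite (le_lt_trans (ler_normD _ _)) // -ltrBrDr.
Qed.

(** A normal vector coming from another defining map h' has inner product o(|x - y0|) with x - y0
    along [M], because h' vanishes there; the multiplier rule for [h] then puts it in the range of
    J(y0)^T. *)
Lemma normal_spaceE : M y0 ->
  Defs.normal_space M y0 = [set w *m (J y0)^T | w in setT].
Proof.
move=> My; apply/seteqP; split => v /=; last first.
  by move=> [w _ <-]; exists k, h; split=> //; exists w.
move=> [k' [h' [hM' [w ->]]]].
have [r r0 hr] := manifold_multiplier.
have [|||mu ->] := hr y0 (adj_diff h' y0 w); last by exists mu.
- by rewrite subrr normr0.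
- by [].
move=> e e0; pose e' : R := e / (k'%:R * `|w| + 1).
have D0 : 0 < k'%:R * `|w| + 1 :> R by rewrite ltr_wpDl // mulr_ge0.
have e'0 : 0 < e' by rewrite divr_gt0.
have [[C1' _] _ /nbhs_rVP[r1 r10 h1]] := hM'.
have [r2 r20 h2] := C1_strict_diff openT C1' (I : setT y0) e'0.
exists (Num.min r1 r2); first by rewrite lt_min r10.
move=> x; rewrite lt_min => /andP[/h1 xr1 xr2] /xr1 hx.
have hy : h' y0 = 0 by apply/h1 => //; rewrite subrr normr0.
have := h2 x y0 xr2; rewrite subrr normr0 hx hy subrr sub0r normrN => /(_ r20) q.
rewrite /adj_diff -dot_mulmx lerNl; apply: le_trans (ler_norm _) _.
rewrite normrN; apply: le_trans (dot_norm_le _ _) _; rewrite mulrAC.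
have kw0 : 0 <= k'%:R * `|w| :> R by rewrite mulr_ge0.
apply: le_trans (ler_wpM2l kw0 q) _; rewrite mulrA ler_wpM2r //.
by rewrite /e' mulrA ler_pdivrMr // mulrC ler_wpM2l ?lerDl // ltW.
Qed.

(** By sharpness the affine span of the projected subdifferential is the whole normal space, so the
    relative interior contains every short normal vector; the vector (dl s) A^T is then the
    projection of a subgradient, and [X] recovers dl s. *)
Lemma normal_ascent_ball (g : 'rV[R]_m -> \bar R) : M y0 ->
  sharp g M y0 -> normal_ascent g M y0 -> exists2 dl : R, 0 < dl &
  forall s : 'rV[R]_k, `|s| <= 1 ->
    exists2 w, subdiff g y0 w & w *m X = dl *: s.
Proof.
move=> My [a aff] [_ [e e0 he]].
have NE := normal_spaceE My.
set A := J y0 in NE *; set P := proj_on (Defs.normal_space M y0) in he.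
have AX : A^T *m gram_inverse A = 1%:M := gram_inverseP defining_gram.
have PE w : P w = w *m gram_inverse A *m A^T.
  by rewrite /P NE proj_on_range //; exact: defining_gram.
pose C : R := m.+1%:R * (k%:R * `|A^T|); have C0 : 0 <= C by rewrite !mulr_ge0.
have C10 : 0 < C + 1 by rewrite ltr_wpDl.
pose dl : R := e / 2 / (C + 1).
have dl0 : 0 < dl by rewrite !divr_gt0.
exists dl => // s s1.
pose z := (dl *: s) *m A^T.
have [||w Sw Pw] := he z; last first.
- exists w => //; have := congr1 (fun v => v *m gram_inverse A) Pw.
  by rewrite PE /z -!mulmxA AX !mulmx1.
- rewrite subr0; apply: le_lt_trans (enorm_le_norm _) _.
  have : `|z| <= k%:R * `|A^T| * dl.
    apply: le_trans (mulmx_norm_le _ _) _; apply: ler_wpM2l.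
      by rewrite mulr_ge0.
    by rewrite normrZ gtr0_norm // ger_pMr.
  move=> /(ler_wpM2l (ler0n R m.+1)) /le_lt_trans; apply.
  rewrite mulrA -/C /dl mulrA ltr_pdivrMr //.
  by have := mulr_ge0 C0 (ltW e0); lra.
(* This point of the translate [a] + N projects to [z]; projecting an affine combination that
   represents it places [z] in the required span. *)
have : affine_span (subdiff g y0) (a + (z - P a)).
  rewrite aff; exists (z - P a) => //; rewrite NE PE /z -mulmxBl.
  by exists (dl *: s - a *m gram_inverse A).
move=> [l [c [v [Sv c1 E]]]].
exists l, c, (fun i => P (v i)); split => //.
  by move=> i; exists (v i).
have -> : \sum_(i < l) c i *: P (v i) = P (a + (z - P a)).
  rewrite E PE !mulmx_suml; apply: eq_bigr => i _.
  by rewrite PE -!scalemxAl.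
have AXA (v' : 'rV[R]_k) : v' *m A^T *m gram_inverse A *m A^T = v' *m A^T.
  by rewrite -(mulmxA v') AX mulmx1.
by rewrite !PE !mulmxDl !mulNmx /z !AXA addrCA subrr addr0.
Qed.

End DefiningMap.

(** Otherwise bad points at distance less than 1 / (n + 1) form a sequence that contradicts the
    inner limit. *)
Lemma inner_limit_near m (M : set 'rV[R]_m) S (y0 w : 'rV[R]_m) :
  inner_limit M S y0 w -> forall e : R, 0 < e ->
  exists2 r : R, 0 < r & forall p : 'rV[R]_m, `|p - y0| < r -> M p ->
    exists2 w', S p w' & `|w' - w| < e.
Proof.
move=> inn e e0; apply: contrapT => hn.
have hn' n : exists p : 'rV[R]_m, [/\ `|p - y0| < n.+1%:R^-1, M p &
    forall w', S p w' -> ~ `|w' - w| < e].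
  apply: contrapT => hp; apply: hn; exists n.+1%:R^-1; first by rewrite invr_gt0.
  move=> p pr Mp; apply: contrapT => hw; apply: hp; exists p; split=> // w' Sw' lt.
  by apply: hw; exists w'.
have [xs hxs] := choice hn'.
have [||vs Svs vsw] := inn xs.
- by move=> n; have [] := hxs n.
- apply/cvgrPdistC_lt => e' e'0.
  near=> n; have [+ _ _] := hxs n; move=> /lt_trans; apply.
  near: n; exact: near_infty_natSinv_lt (PosNum e'0).
have /cvgrPdistC_lt/(_ e e0) close := vsw.
have [n [Sn cn]] := filter_ex (filterI Svs close).
by have [_ _ /(_ _ Sn)] := hxs n.
Unshelve. all: by end_near. Qed.

End PartlySmooth.

(** * Minimization restricted to the manifold *)

Section RestrictedMinimization.
Variables (R : realType) (m k : nat) (M : set 'rV[R]_m) (y0 : 'rV[R]_m).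
Variable h : 'rV[R]_m -> 'rV[R]_k.
Hypothesis hM : defining_map M y0 h.
Hypothesis My0 : M y0.
Variables (g : 'rV[R]_m -> \bar R) (U : set 'rV[R]_m) (G : 'rV[R]_m -> R).
Hypotheses (oU : open U) (Uy0 : U y0) (C1G : C1_on U G).
Hypothesis gG : forall y, U y -> M y -> g y = (G y)%:E.

Local Notation J p := ('J h p).
Local Notation X := (gram_inverse (J y0)).

(** On [M] the functions [g] and [G] agree, so [w] is a first-order lower bound for [G] there and
    the multiplier rule applies to [gradient G p - w]. *)
Lemma frechet_multiplier : exists2 r : R, 0 < r &
  forall p w : 'rV[R]_m, `|p - y0| < r -> M p -> frechet_subdiff g p w ->
  exists mu, w - gradient G p = mu *m (J p)^T.
Proof.
have [r1 r10 h1] := manifold_multiplier hM.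
have /nbhs_rVP[r2 r20 h2] : nbhs y0 U by exact: open_nbhs_nbhs.
exists (Num.min r1 r2); first by rewrite lt_min r10.
move=> p w; rewrite lt_min => /andP[pr1 /h2 Up] Mp [_ fw].
have [mu E] : exists mu, gradient G p - w = mu *m (J p)^T.
  apply: h1 => // e e0.
  pose e' : R := e / (m.+1%:R + 1).
  have D0 : 0 < m.+1%:R + 1 :> R by rewrite ltr_wpDl.
  have e'0 : 0 < e' by rewrite divr_gt0.
  have e'E : e' * (m.+1%:R + 1) = e by rewrite /e' divfK // gt_eqF.
  have /nbhs_rVP[r3 r30 h3] := fw e' e'0.
  have [r4 r40 h4] := C1_gradient oU C1G Up e'0.
  have /nbhs_rVP[r5 r50 h5] : nbhs p U by exact: open_nbhs_nbhs.
  exists (Num.min r3 (Num.min r4 r5)); first by rewrite !lt_min r30 r40.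
  move=> x; rewrite !lt_min => /and3P[/h3 xr3 xr4 /h5 Ux] Mx.
  move: xr3; rewrite !gG // -EFinD lee_fin => fr.
  have := h4 x p xr4; rewrite subrr normr0 => /(_ r40).
  rewrite ler_norml => /andP[_ ub].
  have := ler_wpM2l (ltW e'0) (enorm_le_norm (x - p)).
  rewrite dotBr (dotC _ w) -e'E; move: fr ub.
  set nx := `|x - p|; set ex := enorm _; set a := dot _ _; set b := dot _ _.
  by move=> q1 q2 q3; lra.
by exists (- mu); rewrite mulNmx -E opprB.
Qed.

(** Multiplying the hypothesis by [X] gives mu (1 + B) = (z - grad G(p)) X with B small. Multipliers
    at a moving point [p] are thereby compared in coordinates fixed at [y0]. *)
Lemma multiplier_close : forall e : R, 0 < e -> exists2 r : R, 0 < r &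
  forall (p z : 'rV[R]_m) (mu : 'rV[R]_k), `|p - y0| < r ->
    z - gradient G p = mu *m (J p)^T ->
    `|mu - (z - gradient G y0) *m X| <= e * (1 + `|z|).
Proof.
move=> e e0.
pose C : R := m%:R * `|X|; have C0 : 0 <= C by rewrite mulr_ge0.
pose D : R := `|gradient G y0| + 1; have D0 : 1 <= D by rewrite lerDr.
pose K : R := k%:R; have K0 : 0 <= K by rewrite ler0n.
pose e2 : R := e / (2 * (C + 1)); have e20 : 0 < e2 by rewrite divr_gt0 // mulr_gt0 // ltr_wpDl.
have Ce2 : C * e2 <= e / 2.
  have E : e2 * (C + 1) = e / 2 by rewrite /e2; field; rewrite gt_eqF //; lra.
  by rewrite -E mulrDr mulr1 mulrC lerDl ltW.
pose e3 : R := Num.min (1 / 2) (e / (4 * (C + 1) * D)).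
have CD0 : 0 < 4 * (C + 1) * D by rewrite !mulr_gt0 //; lra.
have e30 : 0 < e3 by rewrite lt_min !divr_gt0.
have e3h : e3 <= 1 / 2 by rewrite ge_min lexx.
have e3C : e3 * (4 * (C + 1) * D) <= e.
  by rewrite -ler_pdivlMr // ge_min lexx orbT.
pose e1 : R := e3 / (K + 1); have e10 : 0 < e1 by rewrite divr_gt0 // ltr_wpDl.
have Ke1 : K * e1 <= e3.
  have E : e1 * (K + 1) = e3 by rewrite /e1 divfK // gt_eqF // ltr_wpDl.
  by rewrite -E mulrDr mulr1 mulrC lerDl ltW.
have [r1 r10 h1] := jacobian_right_inverse hM e10.
have [r2 r20 h2] := gradient_continuous C1G Uy0 e20.
have [r3 r30 h3] := gradient_continuous C1G Uy0 ltr01.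
exists (Num.min r1 (Num.min r2 r3)); first by rewrite !lt_min r10 r20.
move=> p z mu; rewrite !lt_min => /and3P[/h1 p1 /h2 p2 /h3 p3] E.
set B := (J p)^T *m X - 1%:M in p1.
have muE : mu = (z - gradient G p) *m X - mu *m B.
  by rewrite E -(mulmxA mu) /B mulmxBr mulmx1 opprB [RHS]addrC subrK.
have muB : `|mu *m B| <= e3 * `|mu|.
  apply: le_trans (mulmx_norm_le _ _) _; apply: ler_wpM2r => //.
  by apply: le_trans Ke1; exact: ler_wpM2l.
have gp : `|gradient G p| <= D.
  rewrite -[gradient G p](subrK (gradient G y0)) /D.
  by rewrite (le_trans (ler_normD _ _)) // addrC lerD2l.
have zG : `|(z - gradient G p) *m X| <= C * (`|z| + D).
  apply: le_trans (mulmx_norm_le _ _) _; apply: ler_wpM2l => //.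
  by rewrite (le_trans (ler_normB _ _)) // lerD2l.
(* As [e3 <= 1 / 2], the term e3 |mu| is absorbed on the left. *)
have mub : `|mu| <= 2 * (C * (`|z| + D)).
  have : `|mu| <= C * (`|z| + D) + e3 * `|mu|.
    by rewrite {1}muE (le_trans (ler_normB _ _)) // lerD.
  have := ler_wpM2r (normr_ge0 mu) e3h; move: (`|mu|) (C * _) => b1 b2; lra.
have -> : mu - (z - gradient G y0) *m X =
    (gradient G y0 - gradient G p) *m X - mu *m B.
  rewrite {1}muE addrAC -mulmxBl; congr (_ *m _ - _).
  by rewrite opprB addrC addrA subrK.
apply: le_trans (ler_normB _ _) _.
have g1 : `|(gradient G y0 - gradient G p) *m X| <= C * e2.
  rewrite distrC in p2.
  by apply: le_trans (mulmx_norm_le _ _) _; apply: ler_wpM2l p2.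
have g2 : `|mu *m B| <= e / 2 * (1 + `|z|).
  apply: le_trans muB _; apply: le_trans (ler_wpM2l (ltW e30) mub) _.
  have z0 := normr_ge0 z; move: z0; move: (`|z|) => b b0.
  have : C * (b + D) <= (C + 1) * D * (1 + b).
    have D1 : 0 <= D - 1 by lra.
    have D00 : 0 <= D by lra.
    by have := mulr_ge0 (mulr_ge0 C0 b0) D1; have := mulr_ge0 D00 b0; lra.
  move=> /(ler_wpM2l (ltW e30)) => q1.
  have b10 : 0 <= 1 + b by lra.
  by have := ler_wpM2r b10 e3C; lra.
have z0 := mulr_ge0 (ltW e0) (normr_ge0 z).
move: g1 g2 => /le_trans /(_ Ce2); move: (`|_ *m X|) (`|mu *m B|) => b1 b2; lra.
Qed.

Lemma lipschitz_near : exists L : R, exists2 r : R, 0 < r & 0 < L /\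
  forall x x' : 'rV[R]_m, `|x - y0| < r -> `|x' - y0| < r ->
    `|G x - G x'| <= L * `|x - x'|.
Proof.
have [r r0 hr] := C1_gradient oU C1G Uy0 ltr01.
exists (1 + m%:R * `|gradient G y0|); exists r => //; split.
  by rewrite ltr_pwDl // mulr_ge0.
move=> x x' /hr xr /xr {}xr.
have := dot_norm_le (x - x') (gradient G y0); move: xr.
set d := dot _ _; have := ler_normD (G x - G x' - d) d; rewrite subrK.
move: (`|G x - G x'|) (`|_ - d|) (`|d|) (`|x - x'|) => *; lra.
Qed.

(** Comparing the minimizer with [q] keeps it within order [gam] of [y], hence away from the
    boundary of the compact piece on which it was found; it is then a local minimizer on [M] and the
    multiplier rule applies. *)
Lemma restricted_minimizer : exists l : R, 1 <= l /\
  forall rho : R, 0 < rho -> exists2 dt : R, 0 < dt &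
  forall (y q : 'rV[R]_m) (gam : R), `|y - y0| < dt -> 0 < gam -> gam <= dt ->
    M q -> enorm (y - q) <= gam ->
    exists p lam, [/\ M p, `|p - y0| < rho, enorm (y - p) <= l * gam
      & gam^-1 *: (y - p) - gradient G p = lam *m (J p)^T].
Proof.
have [L [r1 r10 [L0 lip]]] := lipschitz_near.
have [r2 r20 h2] := manifold_multiplier hM.
have [r3 r30 h3] := defining_eq hM.
have /nbhs_rVP[r4 r40 h4] : nbhs y0 U by exact: open_nbhs_nbhs.
exists (1 + 2 * L); split; first by rewrite lerDl; lra.
move=> rho rho0.
pose mn : R := Num.min (Num.min rho r1) (Num.min r2 (Num.min r3 r4)).
have mn0 : 0 < mn by rewrite !lt_min rho0 r10 r20 r30.
have [b b0 bmn] : exists2 b : R, 0 < b & b < mn by exists (mn / 2); lra.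
have inb (x : R) : x <= b -> [/\ x < rho, x < r1, x < r2, x < r3 & x < r4].
  move=> /le_lt_trans /(_ bmn).
  by rewrite !lt_min => /andP[/andP[-> ->] /and3P[-> -> ->]].
pose dt : R := b / (2 * (2 + 2 * L)).
have LL0 : 0 < 2 * (2 + 2 * L) by lra.
have dt0 : 0 < dt by rewrite divr_gt0.
have dtE : dt * (2 * (2 + 2 * L)) = b by rewrite /dt divfK // gt_eqF.
exists dt => // y q gam yd g0 gd Mq yq.
pose K := [set p : 'rV[R]_m | `|p - y0| <= b /\ h p = 0].
pose f (u : 'rV[R]_m) := G u + (2 * gam)^-1 * dot (u - y) (u - y).
have qy : `|q - y0| <= b.
  have -> : q - y0 = (q - y) + (y - y0) by rewrite addrA subrK.
  apply: le_trans (ler_normD _ _) _.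
  have : `|q - y| <= gam by rewrite distrC (le_trans (norm_le_enorm _)).
  by move: yd; move: (`|q - y|) (`|y - y0|) => *; nra.
have Kq : K q by split=> //; apply/h3 => //; have [] := inb _ qy.
have [||||p [pb hp] pmin] := @lipschitz_min R m f K
    (L + (2 * gam)^-1 * (m%:R * (2 * b + 2 * dt))) (b + `|y0|).
- by exists q.
- have -> : K = closed_ball_ (fun z => `|z|) y0 b `&` h @^-1` [set 0].
    by apply/seteqP; split => z; rewrite /K /closed_ball_ /= distrC.
  apply: closedI; first exact: closed_closed_ball_.
  apply: closed_comp; last exact/accessible_closed_set1/hausdorff_accessible/norm_hausdorff.
  move=> z _; apply: differentiable_continuous; exact: (defining_C1 hM (I : setT z)).1.
- move=> x [xb _]; rewrite -[x](subrK y0).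
  by rewrite (le_trans (ler_normD _ _)) // lerD2r.
- move=> x x' [xb hx] [x'b hx'].
  have [_ x1 _ _ _] := inb _ xb; have [_ x'1 _ _ _] := inb _ x'b.
  have -> : f x - f x' = (G x - G x')
      + (2 * gam)^-1 * dot (x - x') ((x - y) + (x' - y)).
    have dotB (u v : 'rV[R]_m) : dot (u - v) (u + v) = dot u u - dot v v.
      by rewrite dotBl !dotDr (dotC v u); ring.
    have -> : x - x' = (x - y) - (x' - y) by rewrite opprB addrA subrK.
    by rewrite dotB /f; ring.
  have wle (w : 'rV[R]_m) : `|w - y0| <= b -> `|w - y| <= b + dt.
    move=> wb; have -> : w - y = (w - y0) - (y - y0) by rewrite opprB addrA subrK.
    by rewrite (le_trans (ler_normB _ _)) // lerD // ltW.
  have gam0 : 0 <= (2 * gam)^-1 by rewrite invr_ge0 mulr_ge0 // ltW.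
  apply: le_trans (ler_normD _ _) _; rewrite [leRHS]mulrDl lerD ?lip //.
  rewrite normrM ger0_norm // -mulrA ler_wpM2l //.
  apply: le_trans (dot_norm_le _ _) _; rewrite mulrAC ler_wpM2r // ler_wpM2l //.
  have := lerD (wle _ xb) (wle _ x'b); have := ler_normD (x - y) (x' - y).
  by move: (`|x - y + _|) (`|x - y|) (`|x' - y|) => *; lra.
have := pmin q Kq; rewrite /f -!enorm_sqr (enormBC q) => fpq.
have a0 := enorm_ge0 (p - y); have qb0 := enorm_ge0 (y - q).
have Gpq : G q - G p <= L * (enorm (p - y) + enorm (y - q)).
  have [_ q1 _ _ _] := inb _ qy; have [_ p1 _ _ _] := inb _ pb.
  have : `|q - p| <= enorm (p - y) + enorm (y - q).
    have -> : q - p = - ((p - y) + (y - q)) by rewrite addrA subrK opprB.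
    by rewrite normrN (le_trans (ler_normD _ _)) // lerD // norm_le_enorm.
  move=> /(ler_wpM2l (ltW L0)); apply: le_trans.
  exact: le_trans (ler_norm _) (lip _ _ q1 p1).
(* With a = |p - y| and c = |y - q|, minimality gives a^2 - c^2 <= 2 gam L (a + c); cancelling a + c
   leaves a <= c + 2 L gam. *)
have py : enorm (p - y) <= (1 + 2 * L) * gam.
  have : enorm (p - y) ^+ 2 - enorm (y - q) ^+ 2 <= 2 * gam * (G q - G p).
    have g2 : 0 < 2 * gam by lra.
    rewrite -ler_pdivrMl //; move: fpq; move: (G p) (G q) ((2 * gam)^-1) => *; lra.
  move: Gpq yq a0 qb0; move: (G q - G p) (enorm (p - y)) (enorm (y - q)) => D a c.
  move=> q1 q2 q3 q4 q5; rewrite leNgt; apply/negP => q6.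
  have q7 : D * gam <= L * (a + c) * gam by rewrite ler_wpM2r // ltW.
  have q8 : 0 < (a - c - 2 * L * gam) * (a + c).
    apply: mulr_gt0; nra.
  nra.
have pyb : `|p - y0| < b.
  have -> : p - y0 = (p - y) + (y - y0) by rewrite addrA subrK.
  apply: le_lt_trans (ler_normD _ _) _.
  have := le_trans (norm_le_enorm _) py; move: yd.
  by move: (`|p - y|) (`|y - y0|) => *; nra.
have [p0 p1 p2 p3 p4] := inb _ pb.
have Mp : M p by apply/h3.
have [lam E] : exists lam, gradient G p - gam^-1 *: (y - p) = lam *m (J p)^T.
  apply: h2 => // e e0.
  have e20 : 0 < e / 2 by rewrite divr_gt0.
  have [s1 s10 hs1] := C1_gradient oU C1G (h4 _ p4) e20.
  pose s2 := e * gam / (m%:R + 1).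
  have m0 : 0 < m%:R + 1 :> R by rewrite ltr_wpDl.
  have s20 : 0 < s2 by rewrite divr_gt0 // mulr_gt0.
  exists (Num.min s1 (Num.min s2 (b - `|p - y0|))).
    by rewrite !lt_min s10 s20 subr_gt0.
  move=> x; rewrite !lt_min => /and3P[xs1 xs2 xs3] Mx.
  have xb : `|x - y0| <= b.
    have -> : x - y0 = (x - p) + (p - y0) by rewrite addrA subrK.
    by rewrite (le_trans (ler_normD _ _)) // -lerBrDr ltW.
  have [_ _ _ x3 _] := inb _ xb.
  have := pmin x; rewrite /K /f /= => /(_ (conj xb ((h3 _ x3).1 Mx))).
  have -> : x - y = (x - p) + (p - y) by rewrite addrA subrK.
  rewrite (dot_sqrD (x - p)) => fpx.
  have := hs1 x p xs1; rewrite subrr normr0 => /(_ s10).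
  rewrite ler_norml => /andP[_ ub].
  have := le_trans (ler_norm _) (dot_norm_le (x - p) (x - p)) => dxx.
  rewrite dotBr dotZr -(opprB p y) dotNr mulrN opprK.
  have gE : (2 * gam)^-1 = gam^-1 / 2 by rewrite invfM mulrC.
  have gi0 : 0 <= gam^-1 by rewrite invr_ge0 ltW.
  have : gam^-1 * dot (x - p) (x - p) <= e * `|x - p|.
    apply: le_trans (ler_wpM2l gi0 dxx) _; rewrite mulrA ler_wpM2r //.
    rewrite ler_pdivrMl // mulrC.
    by move: xs2; rewrite ltr_pdivlMr //; have := normr_ge0 (x - p);
       move: (`|x - p|) => *; nra.
  move: fpx ub; rewrite gE; move: (gam^-1) => gi.
  by lra.
exists p, (- lam); split => //; first by rewrite enormBC.
by rewrite mulNmx -E opprB.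
Qed.

End RestrictedMinimization.

(** * From restricted minimizers to proximal points *)

Section ProximalPoint.
Variable R : realType.

Definition sign_row k (s : {ffun 'I_k -> bool}) : 'rV[R]_k :=
  \row_j (-1) ^+ s j.

Lemma sign_row_norm k (s : {ffun 'I_k -> bool}) : `|sign_row s| <= 1.
Proof. by apply: rV_norm_le => // j; rewrite mxE normr_sign. Qed.

(** Choose [s] as the signs of [a]: an error of at most [dl] cannot reverse the sign of a coordinate
    equal to [dl] or [- dl], so every summand is nonnegative. *)
Lemma sign_row_dominates k (mu : {ffun 'I_k -> bool} -> 'rV[R]_k)
    (lam a : 'rV[R]_k) (dl : R) :
  (forall s, `|mu s - lam - dl *: sign_row s| <= dl) ->
  exists s, 0 <= dot (mu s - lam) a.
Proof.
move=> mul; exists [ffun j => a 0 j < 0]; set s := finfun _.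
apply: sumr_ge0 => j _.
have := le_trans (rV_coord_le (mu s - lam - dl *: sign_row s) j) (mul s).
rewrite !mxE ffunE; set t := mu s 0 j - lam 0 j.
rewrite ler_norml => /andP[q1 q2].
case: ltP q1 q2 => a0 /=; rewrite ?expr1 ?expr0 => q1 q2.
  by apply: mulr_le0; [lra | exact: ltW].
by rewrite mulr_ge0 //; lra.
Qed.

(** Split y - p = (y - q) + (q - p). The first part is small by the choice of [kap]; the second
    joins two zeros of [h], so strict differentiability makes its image under the Jacobian small
    relative to |q - p|, which is of order [gam]. *)
Lemma normal_part_small m k (M : set 'rV[R]_m) (y0 : 'rV[R]_m)
    (h : 'rV[R]_m -> 'rV[R]_k) (l e : R) :
  defining_map M y0 h -> 0 <= l -> 0 < e ->
  exists kap rho : R, [/\ 0 < kap, kap <= 1, 0 < rho &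
  forall (y p q : 'rV[R]_m) (gam : R), `|p - y0| < rho -> `|q - y0| < rho ->
    M p -> M q -> 0 < gam -> enorm (y - q) <= kap * gam ->
    enorm (y - p) <= l * gam ->
    `|gam^-1 *: (y - p) *m gram_inverse ('J h y0)| <= e].
Proof.
move=> hM l0 e0.
set A := 'J h y0; set S := invmx (A^T *m A).
pose C1 : R := k%:R * `|S|; have C10 : 0 <= C1 by rewrite mulr_ge0.
pose C2 : R := m%:R * `|A|; have C20 : 0 <= C2 by rewrite mulr_ge0.
have CC0 : 0 <= C1 * C2 by rewrite mulr_ge0.
pose kap : R := Num.min 1 (e / (2 * (C1 * C2 + 1))).
have D1 : 0 < 2 * (C1 * C2 + 1) by lra.
have kap0 : 0 < kap by rewrite lt_min ltr01 divr_gt0.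
have kapC : C1 * (C2 * kap) <= e / 2.
  have : kap * (2 * (C1 * C2 + 1)) <= e.
    by rewrite -ler_pdivlMr // ge_min lexx orbT.
  by move: (kap) kap0 => t t0; nra.
have kap1 : kap <= 1 by rewrite ge_min lexx.
have D2 : 0 < 2 * (C1 + 1) * (1 + l) by rewrite !mulr_gt0 //; lra.
pose eta : R := e / (2 * (C1 + 1) * (1 + l)).
have eta0 : 0 < eta by rewrite divr_gt0.
have etaE : eta * (2 * (C1 + 1) * (1 + l)) = e by rewrite /eta divfK // gt_eqF.
have [r1 r10 h1] := defining_strict hM y0 eta0.
have [r2 r20 h2] := defining_eq hM.
exists kap, (Num.min r1 r2); split=> //; first by rewrite lt_min r10.
move=> y p q gam; rewrite !lt_min => /andP[p1 p2] /andP[q1 q2] Mp Mq g0 yq yp.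
rewrite -scalemxAl normrZ gtr0_norm ?invr_gt0 // ler_pdivrMl //.
rewrite /gram_inverse -/A -/S mulmxA.
apply: le_trans (mulmx_norm_le _ _) _.
have -> : (y - p) *m A = (y - q) *m A + (q - p) *m A.
  by rewrite -mulmxDl addrA subrK.
have := h1 q p q1 p1.
have -> : h q = 0 by exact/h2.
have -> : h p = 0 by exact/h2.
rewrite subrr sub0r normrN -/A => qpA.
have qp : `|q - p| <= (1 + l) * gam.
  have -> : q - p = (y - p) - (y - q) by rewrite opprB [RHS]addrC addrA subrK.
  apply: le_trans (ler_normB _ _) _.
  have := le_trans (norm_le_enorm _) yq; have := le_trans (norm_le_enorm _) yp.
  have := ler_wpM2r (ltW g0) kap1.
  by move: (`|y - p|) (`|y - q|) (kap) => *; lra.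
have yqA : `|(y - q) *m A| <= C2 * (kap * gam).
  apply: le_trans (mulmx_norm_le _ _) _; apply: ler_wpM2l => //.
  exact: le_trans (norm_le_enorm _) yq.
have {}qpA : `|(q - p) *m A| <= eta * ((1 + l) * gam).
  by apply: le_trans qpA _; apply: ler_wpM2l => //; exact: ltW.
rewrite -/C1.
have := ler_wpM2l C10 (le_trans (ler_normD _ _) (lerD yqA qpA)).
move=> /le_trans; apply.
have := ler_wpM2r (ltW g0) kapC.
have q3 : C1 * eta * (1 + l) <= e / 2.
  have : 0 <= eta * (1 + l) by rewrite mulr_ge0 //; lra.
  by move: etaE; move: (eta) => t; lra.
have := ler_wpM2r (ltW g0) q3; lra.
Qed.

Section Local.
Variables (m k : nat) (M : set 'rV[R]_m) (y0 : 'rV[R]_m).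
Variable h : 'rV[R]_m -> 'rV[R]_k.
Hypothesis hM : defining_map M y0 h.
Hypothesis My0 : M y0.
Variables (g : 'rV[R]_m -> \bar R) (U : set 'rV[R]_m) (G : 'rV[R]_m -> R).
Hypotheses (oU : open U) (Uy0 : U y0) (C1G : C1_on U G).
Hypothesis gG : forall y, U y -> M y -> g y = (G y)%:E.
Hypothesis reg : \forall y \near y0, M y -> clarke_regular g y /\ subdiff g y !=set0.
Hypothesis subcont : set_continuous_within M (subdiff g) y0.
Hypothesis preg : prox_regular g y0.
Hypotheses (sh : sharp g M y0) (asc : normal_ascent g M y0).

Local Notation J p := ('J h p).
Local Notation X := (gram_inverse (J y0)).

(** One parameter plays both roles, [tau] as radius and [tau^-1] as modulus: decreasing it weakens
    the claim, as [uniform_radius] requires. *)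
Lemma uniform_prox_regular (T : finType) (wb : T -> 'rV[R]_m) :
  (forall s, subdiff g y0 (wb s)) ->
  exists2 tau : R, 0 < tau & forall s (y y' v : 'rV[R]_m), subdiff g y v ->
    enorm (y - y0) < tau -> enorm (y' - y0) < tau -> enorm (v - wb s) < tau ->
    (g y < g y0 + tau%:E)%E ->
    (g y + (dot v (y' - y) - tau^-1 / 2 * enorm (y' - y) ^+ 2)%:E <= g y')%E.
Proof.
move=> Swb.
pose P (s : T) (tau : R) := 0 < tau -> forall (y y' v : 'rV[R]_m), subdiff g y v ->
    enorm (y - y0) < tau -> enorm (y' - y0) < tau -> enorm (v - wb s) < tau ->
    (g y < g y0 + tau%:E)%E ->
    (g y + (dot v (y' - y) - tau^-1 / 2 * enorm (y' - y) ^+ 2)%:E <= g y')%E.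
have [||tau tau0 htau] := @uniform_radius R T P.
- move=> s r r' r'r Pr r'0 y y' v Sv yr y'r vr gy.
  have r0 := lt_le_trans r'0 r'r.
  have := Pr r0 y y' v Sv (lt_le_trans yr r'r) (lt_le_trans y'r r'r)
    (lt_le_trans vr r'r) (lt_le_trans gy _).
  rewrite leeD2l ?lee_fin // => /(_ isT); apply: le_trans.
  rewrite leeD2l // lee_fin lerD2l lerN2 ler_wpM2r ?sqr_ge0 //.
  by rewrite ler_wpM2r // lef_pV2.
- move=> s; have [_ _ [r [e [r0 e0 hr]]]] := preg (Swb s).
  pose t : R := Num.min e r^-1.
  have te : t <= e by rewrite ge_min lexx.
  have tr : t <= r^-1 by rewrite ge_min lexx orbT.
  exists t; first by rewrite lt_min e0 invr_gt0.
  move=> t0 y y' v Sv yr y'r vr gy.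
  have := hr y y' v Sv (lt_le_trans yr te) (lt_le_trans y'r te)
    (lt_le_trans vr te) (lt_le_trans gy _).
  rewrite leeD2l ?lee_fin // => /(_ isT); apply: le_trans.
  rewrite leeD2l // lee_fin lerD2l lerN2 ler_wpM2r ?sqr_ge0 //.
  rewrite ler_wpM2r // -[r]invrK lef_pV2 ?posrE ?invr_gt0 //.
by exists tau => // s; exact: htau.
Qed.

Lemma prox_local : exists l kap eps r dt : R,
  [/\ 0 <= l, 0 < kap, 0 < eps, 0 < dt &
  forall (y q : 'rV[R]_m) (gam : R), `|y - y0| < dt -> 0 < gam -> gam <= dt ->
    M q -> enorm (y - q) <= kap * gam ->
    exists p, [/\ M p, g p = (G p)%:E, enorm (y - p) <= l * gam,
      G p <= G y0 + 1 & forall y', enorm (y' - y0) < eps ->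
      ((G p + (dot (gam^-1 *: (y - p)) (y' - p)
         - r * enorm (y' - p) ^+ 2))%:E <= g y')%E]].
Proof.
have [l [l1 hmin]] := restricted_minimizer hM oU Uy0 C1G.
have l0 : 0 <= l by exact: le_trans l1.
have [dl dl0 hdl] := normal_ascent_ball hM My0 sh asc.
have /choice[wb hwb] : forall s : {ffun 'I_k -> bool}, exists w,
    subdiff g y0 w /\ w *m X = dl *: sign_row s.
  by move=> s; have [w Sw wX] := hdl _ (sign_row_norm s); exists w.
have [tau tau0 htau] := uniform_prox_regular (fun s => (hwb s).1).
have dl40 : 0 < dl / 4 by rewrite divr_gt0.
(* [multiplier_close] has error proportional to 1 + |z|. Here 2 + |wb s| bounds this factor for
   subgradients within 1 of [wb s]; below, [1 + l] bounds it for [v]. *)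
have [||e1 e10 he1] := @uniform_radius R {ffun 'I_k -> bool}
    (fun s t => t * (2 + `|wb s|) <= dl / 4).
- by move=> s r r' r'r; apply: le_trans; rewrite ler_wpM2r // addr_ge0.
- move=> s; have D0 : 0 < 2 + `|wb s| by rewrite ltr_wpDr.
  by exists (dl / 4 / (2 + `|wb s|)); rewrite ?divr_gt0 // divfK // gt_eqF.
pose e2 : R := dl / 4 / (1 + l).
have e20 : 0 < e2 by rewrite divr_gt0 //; lra.
have e2E : e2 * (1 + l) = dl / 4 by rewrite /e2 divfK // gt_eqF //; lra.
have [eB [eB0 eB1 eB2]] : exists eB : R, [/\ 0 < eB, eB <= e1 & eB <= e2].
  exists (Num.min e1 e2); rewrite lt_min e10 e20; split=> //.
    by rewrite ge_min lexx.
  by rewrite ge_min lexx orbT.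
pose Cx : R := m%:R * `|X|; have Cx0 : 0 <= Cx by rewrite mulr_ge0.
have [ew [ew0 ew1 ewt ewC]] : exists ew : R,
    [/\ 0 < ew, ew <= 1, m.+1%:R * ew <= tau & Cx * ew <= dl / 4].
  exists (Num.min 1 (Num.min (tau / m.+1%:R) (dl / 4 / (Cx + 1)))); split.
  - by rewrite !lt_min ltr01 !divr_gt0 // ltr_wpDl.
  - by rewrite ge_min lexx.
  - by rewrite mulrC -ler_pdivlMr // !ge_min lexx orbT.
  - have Cx1 : 0 < Cx + 1 by rewrite ltr_wpDl.
    have : Num.min 1 (Num.min (tau / m.+1%:R) (dl / 4 / (Cx + 1))) <=
      dl / 4 / (Cx + 1) by rewrite !ge_min lexx !orbT.
    move=> /(ler_wpM2l Cx0) /le_trans; apply.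
    by rewrite mulrCA ger_pMr // ler_pdivrMr // mul1r lerDl.
have [||r1 r10 hr1] := @uniform_radius R {ffun 'I_k -> bool}
    (fun s r => forall p : 'rV[R]_m, `|p - y0| < r -> M p ->
      exists2 w', subdiff g p w' & `|w' - wb s| < ew).
- by move=> s r r' r'r H p pr; apply: H; exact: lt_le_trans r'r.
- by move=> s; apply: (inner_limit_near (subcont.2 _ (hwb s).1) ew0).
have [r2 r20 hr2] := frechet_multiplier hM oU Uy0 C1G gG.
have [r3 r30 hr3] := multiplier_close hM Uy0 C1G eB0.
have /nbhs_rVP[r4 r40 hr4] := reg.
have /nbhs_rVP[r5 r50 hr5] : nbhs y0 U by exact: open_nbhs_nbhs.
have [kap [r6 [kap0 kap1 r60 hr6]]] := normal_part_small hM l0 dl40.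
have [L [r7 r70 [L0 lip]]] := lipschitz_near oU Uy0 C1G.
have [r8 r80 hr8] : exists2 r8 : R, 0 < r8 & forall x, x < r8 ->
    [/\ m.+1%:R * x < tau, L * x < tau & L * x <= 1].
  exists (Num.min (tau / m.+1%:R) (Num.min (tau / L) (1 / L))).
    by rewrite !lt_min !divr_gt0.
  move=> x; rewrite !lt_min !ltr_pdivlMr // => /and3P[u1 u2 u3].
  by rewrite mulrC u1 mulrC u2 ltW // mulrC.
pose rho : R := Num.min (Num.min (Num.min r1 r2) (Num.min r3 r4))
                  (Num.min (Num.min r5 r6) (Num.min r7 r8)).
have rho0 : 0 < rho by rewrite !lt_min r10 r20 r30 r40 r50 r60 r70 r80.
have [dt dt0 hdt] := hmin rho rho0.
exists l, kap, tau, (tau^-1 / 2), (Num.min dt (rho / 2)); split=> //.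
  by rewrite lt_min dt0 divr_gt0.
move=> y q gam; rewrite lt_min le_min => /andP[yd yr] gam0 /andP[gd gr] Mq yq.
have kg : kap * gam <= gam by rewrite ger_pMl.
have [p [lam [Mp pr yp lamE]]] := hdt y q gam yd gam0 gd Mq (le_trans yq kg).
have qr : `|q - y0| < rho.
  have -> : q - y0 = (y - y0) - (y - q) by rewrite opprB [RHS]addrC addrA subrK.
  apply: le_lt_trans (ler_normB _ _) _.
  have := le_trans (norm_le_enorm _) (le_trans yq kg).
  by move: yr; move: (`|y - y0|) (`|y - q|) (rho) gr => *; lra.
have near_p : [/\ `|p - y0| < r1, `|p - y0| < r2, `|p - y0| < r3 & `|p - y0| < r4]
    /\ [/\ `|p - y0| < r5, `|p - y0| < r6, `|p - y0| < r7 & `|p - y0| < r8].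
  by move: pr; rewrite !lt_min =>
    /andP[/andP[/andP[-> ->] /andP[-> ->]] /andP[/andP[-> ->] /andP[-> ->]]].
have [[p1 p2 p3 p4] [p5 p6 p7 p8]] := near_p.
have q6 : `|q - y0| < r6.
  by move: qr; rewrite !lt_min => /andP[_ /andP[/andP[_ ->] _]].
have [ptau pL p1L] := hr8 _ p8.
have gp : g p = (G p)%:E by apply: gG => //; exact: hr5.
have Gp : G p - G y0 <= L * `|p - y0|.
  by apply: le_trans (ler_norm _) (lip _ _ p7 _); rewrite subrr normr0.
exists p; split=> //; first by lra.
move=> y' y'tau; set v := gam^-1 *: (y - p).
(* The subgradient depends on [y']: the signs of the coordinates of [(y' - p) *m J p] select it. *)
have [s hs] : exists s w, [/\ subdiff g p w, `|w - wb s| < ew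
    & 0 <= dot (w - v) (y' - p)].
  have /choice[w hw] : forall s, exists w, subdiff g p w /\ `|w - wb s| < ew.
    by move=> s; have [w ? ?] := hr1 s p p1 Mp; exists w.
  have /choice[mu hmu] : forall s, exists mu, w s - gradient G p = mu *m (J p)^T.
    move=> s; apply: hr2 => //; have [cr _] := hr4 _ p4 Mp.
    by rewrite -cr; exact: (hw s).1.
  have [|s hs] := @sign_row_dominates k mu lam ((y' - p) *m J p) dl.
    move=> s; have [Sw ww] := hw s.
    have w1 : `|w s| <= `|wb s| + 1.
      rewrite -[w s](subrK (wb s)) addrC (le_trans (ler_normD _ _)) //.
      by rewrite lerD2l (le_trans (ltW ww)).
    have m1 := hr3 p (w s) (mu s) p3 (hmu s).
    have m2 := hr3 p v lam p3 lamE.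
    have m3 : `|(w s - wb s) *m X| <= dl / 4.
      apply: le_trans (mulmx_norm_le _ _) _; apply: le_trans ewC.
      by apply: ler_wpM2l => //; exact: ltW.
    have m4 := hr6 y p q gam p6 q6 Mp Mq gam0 yq yp.
    have v1 : `|v| <= l.
      rewrite /v normrZ gtr0_norm ?invr_gt0 // ler_pdivrMl // mulrC.
      exact: le_trans (norm_le_enorm _) yp.
    have {}m1 : `|mu s - (w s - gradient G y0) *m X| <= dl / 4.
      apply: le_trans m1 _; apply: le_trans (he1 s).
      apply: ler_pM => //; first exact: ltW.
      by move: w1; move: (`|w s|) (`|wb s|) => *; lra.
    have {}m2 : `|lam - (v - gradient G y0) *m X| <= dl / 4.
      apply: le_trans m2 _; rewrite -e2E.
      apply: ler_pM => //; first exact: ltW.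
      by rewrite lerD2l.
    (* Four errors of at most [dl / 4]: the multipliers of [w s] and of [v], the displacement from
       [wb s] to [w s], and the normal coordinates of [v]. The gradient terms cancel. *)
    have -> : mu s - lam - dl *: sign_row s =
      (mu s - (w s - gradient G y0) *m X) - (lam - (v - gradient G y0) *m X)
      + (w s - wb s) *m X - v *m X.
      rewrite -(hwb s).2 !mulmxBl; apply/rowP => i.
      by rewrite ![in LHS]mxE ![in RHS]mxE; ring.
    apply: le_trans (ler_normB _ _) _.
    have t1 := ler_normD ((mu s - (w s - gradient G y0) *m X)
      - (lam - (v - gradient G y0) *m X)) ((w s - wb s) *m X).
    have t2 := ler_normB (mu s - (w s - gradient G y0) *m X)
      (lam - (v - gradient G y0) *m X).
    move: t1 t2 m1 m2 m3 m4; rewrite -/v.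
    move: (`|_ - _ + _|) (`|_ - _ - (_ - _)|) (`|mu s - _|) (`|lam - _|)
      (`|_ *m X|) (`|v *m X|) => *; lra.
  exists s, (w s); have [Sw ww] := hw s; split=> //.
  have -> : w s - v = (mu s - lam) *m (J p)^T.
    by rewrite mulmxBl -hmu -lamE opprB addrA subrK.
  by rewrite dot_mulmx trmxK.
have [w [Sw ww dw]] := hs.
have ptau' : enorm (p - y0) < tau by exact: le_lt_trans (enorm_le_norm _) ptau.
have wtau : enorm (w - wb s) < tau.
  apply: le_lt_trans (enorm_le_norm _) _; apply: lt_le_trans ewt.
  by rewrite ltr_pM2l.
have gtau : (g p < g y0 + tau%:E)%E.
  by rewrite gp (gG Uy0 My0) -EFinD lte_fin; lra.
have := htau s p y' w Sw ptau' y'tau wtau gtau; rewrite gp => H.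
apply: le_trans H; rewrite -EFinD lee_fin lerD2l lerD2r.
by rewrite -subr_ge0 -dotBl.
Qed.

End Local.
End ProximalPoint.

(** * From the local inequality to global, unique minimality *)

Section Global.
Variable R : realType.

Lemma prox_singleton m (g : 'rV[R]_m -> \bar R) (y0 : 'rV[R]_m)
    (l eps r B : R) :
  (forall y, g y != -oo%E) -> prox_bounded g -> 0 < eps ->
  exists2 Gam : R, 0 < Gam & forall (y p : 'rV[R]_m) (gam Gp : R),
    enorm (y - y0) <= eps / 2 -> 0 < gam -> gam <= Gam ->
    enorm (y - p) <= l * gam -> g p = Gp%:E -> Gp <= B ->
    (forall y', enorm (y' - y0) < eps ->
      ((Gp + (dot (gam^-1 *: (y - p)) (y' - p)
         - r * enorm (y' - p) ^+ 2))%:E <= g y')%E) ->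
    prox gam g y = [set p].
Proof.
move=> gN [rb rb0 [b hb]] eps0.
pose Q : R := `|B + l ^+ 2 / 2 - b + rb * dot y0 y0| + 1.
have Q0 : 0 < Q by rewrite ltr_wpDl.
have eps20 : 0 < eps ^+ 2 by rewrite exprn_gt0.
(* A lower bound for c = 1 / (2 gam): |r| handles competitors near [y0]; the first term handles the
   others, for which |w - y|^2 >= |w - y0|^2 / 4 and [Q] exceeds the constants to be beaten. *)
pose K : R := 4 * (rb + Q / eps ^+ 2) + `|r| + 1.
have QE0 : 0 < Q / eps ^+ 2 by rewrite divr_gt0.
have r0 := normr_ge0 r.
have K0 : 0 < K by rewrite /K; lra.
exists (Num.min 1 (1 / (2 * K))).
  by rewrite lt_min ltr01 divr_gt0 // mulr_gt0.
move=> y p gam Gp yy0 gam0; rewrite le_min => /andP[gam1 gamK] yp gpE GpB loc.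
pose c : R := (2 * gam)^-1.
have c0 : 0 < c by rewrite invr_gt0 mulr_gt0.
have cE : gam^-1 = 2 * c.
  by rewrite /c invfM mulrA mulfV // mul1r.
have Kc : K <= c.
  rewrite /c -[K]invrK lef_pV2 ?posrE ?invr_gt0 ?mulr_gt0 //.
  by move: gamK; rewrite div1r invfM; move: (K^-1) => *; lra.
have strict w s : w != p -> g w = s%:E ->
    Gp + c * enorm (p - y) ^+ 2 < s + c * enorm (w - y) ^+ 2.
  move=> wp gw.
  have [wn|wf] := ltP (enorm (w - y0)) eps.
    (* The linear term cancels the cross term of |w - y|^2 expanded around [p], leaving a gain of (c
       - r) |w - p|^2. *)
    have := loc w wn; rewrite gw lee_fin dotZl cE !enorm_sqr.
    have -> : y - p = - (p - y) by rewrite opprB.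
    have -> : w - y = (p - y) + (w - p) by rewrite [RHS]addrC addrA subrK.
    rewrite (dot_sqrD (p - y)) dotNl.
    have wp0 : 0 < dot (w - p) (w - p).
      rewrite -enorm_sqr exprn_gt0 // lt_neqAle enorm_ge0 andbT eq_sym.
      by apply: contra wp => /eqP/enorm0_eq0/eqP; rewrite subr_eq0.
    have : 0 < (c - r) * dot (w - p) (w - p).
      rewrite mulr_gt0 // subr_gt0 (le_lt_trans (ler_norm _)) //.
      by apply: lt_le_trans Kc; rewrite /K; lra.
    lra.
  have D2 : eps ^+ 2 <= dot (w - y0) (w - y0).
    by rewrite -enorm_sqr ler_pXn2r ?nnegrE ?enorm_ge0 // ltW.
  have y2 : dot (y - y0) (y - y0) <= eps ^+ 2 / 4.
    have -> : eps ^+ 2 / 4 = (eps / 2) ^+ 2 by field.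
    by rewrite -enorm_sqr ler_pXn2r ?nnegrE ?enorm_ge0 // ltW // divr_gt0.
  have := hb w; rewrite gw lee_fin enorm_sqr => bw.
  have w2 : dot w w <= 2 * dot (w - y0) (w - y0) + 2 * dot y0 y0.
    by have := dot_sqrD_le (w - y0) y0; rewrite subrK.
  have wy : dot (w - y0) (w - y0) <= 2 * dot (w - y) (w - y) + 2 * dot (y - y0) (y - y0).
    have := dot_sqrD_le (w - y) (y - y0).
    by have -> : w - y + (y - y0) = w - y0 by rewrite addrA subrK.
  have cp : c * enorm (p - y) ^+ 2 <= l ^+ 2 / 2.
    have h1 : enorm (p - y) ^+ 2 <= (l * gam) ^+ 2.
      rewrite enormBC ler_pXn2r ?nnegrE ?enorm_ge0 //.
      exact: le_trans (enorm_ge0 _) yp.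
    apply: le_trans (ler_wpM2l (ltW c0) h1) _.
    have -> : c * (l * gam) ^+ 2 = l ^+ 2 / 2 * gam.
      by rewrite /c; field; rewrite gt_eqF.
    by apply: ler_piMr gam1; rewrite mulr_ge0 ?sqr_ge0.
  have Qn := ler_norm (B + l ^+ 2 / 2 - b + rb * dot y0 y0).
  have cQ : Q <= (c / 4 - rb) * dot (w - y0) (w - y0).
    have : Q / eps ^+ 2 <= c / 4 - rb by move: Kc; rewrite /K; lra.
    have cr0 : 0 <= c / 4 - rb by move: Kc; rewrite /K; lra.
    rewrite ler_pdivrMr // => /le_trans; apply; exact: ler_wpM2l.
  have w4 : dot (w - y0) (w - y0) / 4 <= dot (w - y) (w - y) by lra.
  have := ler_wpM2l (ltW c0) w4; have := ler_wpM2l rb0 w2.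
  move: cQ Qn bw cp; rewrite (enorm_sqr (w - y)) /Q; lra.
apply/seteqP; split => [u pu|_ -> w] /=.
  apply/eqP; apply: contraT => up.
  have := pu p; rewrite gpE; case gu : (g u) => [s| |].
  - rewrite -!EFinD lee_fin -/c => /(lt_le_trans (strict u s up gu)).
    by rewrite ltxx.
  - by rewrite addye // leye_eq.
  - by have := gN u; rewrite gu.
have [->//|wp] := eqVneq w p.
case gw : (g w) => [s| |]; rewrite gpE.
- by rewrite -!EFinD lee_fin ltW // strict.
- by rewrite addye // leey.
- by have := gN w; rewrite gw.
Qed.

Lemma prox_manifold m (g : 'rV[R]_m -> \bar R) (M : set 'rV[R]_m)
    (y0 : 'rV[R]_m) :
  (forall y, g y != -oo%E) -> prox_bounded g -> prox_regular g y0 ->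
  partly_smooth g M y0 -> normal_ascent g M y0 ->
  exists kap dt : R, [/\ 0 < kap, 0 < dt &
  forall (y q : 'rV[R]_m) (gam : R), `|y - y0| < dt -> 0 < gam -> gam <= dt ->
    M q -> enorm (y - q) <= kap * gam -> prox_in gam g y M].
Proof.
move=> gN pb preg [[My0 [k [h hM]]] [[U [G [oU Uy0 [C1G _] gG]]] reg sh sc]] asc.
have [l [kap [eps [r [dt [l0 kap0 eps0 dt0 loc]]]]]] :=
  prox_local hM My0 oU Uy0 C1G gG reg sc preg sh asc.
have [Gam Gam0 glob] := @prox_singleton m g y0 l eps r (G y0 + 1) gN pb eps0.
pose d : R := Num.min (Num.min dt Gam) (eps / 2 / m.+1%:R).
exists kap, d; split=> //; first by rewrite !lt_min dt0 Gam0 !divr_gt0.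
move=> y q gam; rewrite /d !lt_min !le_min => /andP[/andP[y1 _] y3] gam0.
move=> /andP[/andP[g1 g2] _] Mq yq.
have [p [Mp gp yp Gp lp]] := loc y q gam y1 gam0 g1 Mq yq.
exists p => //; apply: (glob y p gam (G p)) => //.
apply: le_trans (enorm_le_norm _) _.
by rewrite mulrC -ler_pdivlMr // ltW.
Qed.

End Global.

(** * The threshold function and the distance *)

Section Phi.
Variable R : realType.

Lemma phi_root (K t : R) : 0 <= phi_discr 1 K 1 t ->
  phi 1 K 1 t ^+ 2 = phi 1 K 1 t - K * t.
Proof.
move=> d0; have := sqr_sqrtr d0; rewrite /phi; set s := Num.sqrt _.
rewrite /phi_discr expr1n divr1 => sE.
have -> : K * t = (1 - s ^+ 2) / 4 by rewrite sE; field.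
by field.
Qed.

(** Rationalizing, phi times 1 + sqrt(discriminant) is 2 K t, and that factor is at least 1. *)
Lemma phi_norm_le (K t : R) : 0 <= K -> 0 <= phi_discr 1 K 1 t ->
  `|phi 1 K 1 t| <= 2 * K * `|t|.
Proof.
move=> K0 d0; pose s := Num.sqrt (phi_discr 1 K 1 t).
have s0 : 0 <= s by exact: sqrtr_ge0.
have E : phi 1 K 1 t * (1 + s) = 2 * K * t.
  have := phi_root d0; rewrite /phi -/s; lra.
have -> : 2 * K * `|t| = `|2 * K * t| by rewrite normrM [`|2 * K|]ger0_norm // mulr_ge0.
rewrite -E [leRHS]normrM ler_peMr // ger0_norm; lra.
Qed.

Lemma phi_ge (K t : R) : 0 <= phi_discr 1 K 1 t -> K * t <= phi 1 K 1 t.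
Proof. by move=> d0; rewrite -subr_ge0 -phi_root // sqr_ge0. Qed.

(* [phi] is a root of [x ^+ 2 - x + K * t], so its remainder after order two *)
(* is [phi ^+ 2 - (K * t) ^+ 2 = phi ^+ 2 * (phi + K * t)]. *)
Lemma phi_expansion (K : R) : 0 < K ->
  phi 1 K 1 = (fun t : R => K / 1 * t + 1 * K ^+ 2 / 1 ^+ 3 * t ^+ 2)
    +o_ (0 : R) (fun t : R => t ^+ 2).
Proof.
move=> K0; apply/eqaddoP => e e0.
have K30 : 0 < 12 * K ^+ 3 by rewrite mulr_gt0 // exprn_gt0.
apply/nbhs_ballP; exists (Num.min (1 / (4 * K)) (e / (12 * K ^+ 3))).
  by rewrite /= lt_min !divr_gt0 // mulr_gt0.
move=> t; rewrite -ball_normE /= sub0r normrN lt_min => /andP[t1 t2].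
have d0 : 0 <= phi_discr 1 K 1 t.
  rewrite /phi_discr expr1n divr1 mulr1.
  move: t1; rewrite ltr_pdivlMr ?mulr_gt0 // => t1.
  have := ler_wpM2l (ltW K0) (ler_norm t); lra.
have := phi_norm_le (ltW K0) d0.
rewrite -[(_ - _) t]/(phi 1 K 1 t - (K / 1 * t + 1 * K ^+ 2 / 1 ^+ 3 * t ^+ 2)).
have -> : phi 1 K 1 t - (K / 1 * t + 1 * K ^+ 2 / 1 ^+ 3 * t ^+ 2) =
    phi 1 K 1 t ^+ 2 * (phi 1 K 1 t + K * t).
  rewrite expr1n !divr1 mul1r phi_root //.
  have := phi_root d0; set p := phi _ _ _ _ => pE.
  have -> : (p - K * t) * (p + K * t) = p ^+ 2 - K ^+ 2 * t ^+ 2 by ring.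
  by rewrite pE; ring.
move: (phi 1 K 1 t) => p p1.
rewrite [`|t ^+ 2|]normrX [leLHS]normrM [`|p ^+ 2|]normrX.
have p2 : `|p + K * t| <= 3 * K * `|t|.
  rewrite (le_trans (ler_normD _ _)) // normrM (gtr0_norm K0); lra.
apply: (@le_trans _ _ ((2 * K * `|t|) ^+ 2 * (3 * K * `|t|))).
  by apply: ler_pM => //; rewrite ?exprn_ge0 // ler_pXn2r ?nnegrE // !mulr_ge0 // ltW.
have -> : (2 * K * `|t|) ^+ 2 * (3 * K * `|t|) = (`|t| * (12 * K ^+ 3)) * `|t| ^+ 2.
  by ring.
by rewrite ler_wpM2r ?sqr_ge0 // ltW // -ltr_pdivlMr.
Qed.

End Phi.

Section Distance.
Variables (R : realType) (n : nat) (A : set 'rV[R]_n).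

Lemma dist_to_lbound x : lbound [set enorm (x - z) | z in A] 0.
Proof. by move=> _ [z _ <-]; exact: enorm_ge0. Qed.

Lemma dist_to_le x z : A z -> dist_to A x <= enorm (x - z).
Proof.
move=> Az; apply: ge_inf; last by exists z.
by exists 0; exact: dist_to_lbound.
Qed.

Lemma dist_to_near x (e : R) : A !=set0 -> dist_to A x < e ->
  exists2 z, A z & enorm (x - z) < e.
Proof.
move=> [a Aa] de.
have [||_ [z Az <-] xz] := @inf_adherent _ [set enorm (x - z) | z in A] (e - dist_to A x).
- by rewrite subr_gt0.
- by split; [exists (enorm (x - a)), a | exists 0; exact: dist_to_lbound].
by exists z => //; move: xz; rewrite /dist_to [ltRHS]addrC subrK.
Qed.

End Distance.

Lemma C1_lipschitz (R : realType) n m (c : 'rV[R]_n -> 'rV[R]_m) U x0 :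
  open U -> C1_on U c -> U x0 ->
  exists L r : R, [/\ 0 < L, 0 < r & forall x x', `|x - x0| < r ->
    `|x' - x0| < r -> enorm (c x - c x') <= L * `|x - x'|].
Proof.
move=> oU C1 Ux.
have [r r0 hr] := C1_strict_diff oU C1 Ux ltr01.
pose K : R := 1 + n%:R * `|'J c x0|.
have K0 : 0 < K by rewrite ltr_wpDr // mulr_ge0.
exists (m.+1%:R * K), r; split=> //; first by rewrite mulr_gt0.
move=> x x' xr x'r; apply: le_trans (enorm_le_norm _) _.
rewrite -mulrA ler_wpM2l //.
have := hr x x' xr x'r; have := mulmx_norm_le (x - x') ('J c x0).
have := ler_normD (c x - c x' - (x - x') *m 'J c x0) ((x - x') *m 'J c x0).
rewrite subrK mul1r /K mulrDl mul1r => q1 q2 q3.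
by apply: le_trans q1 _; exact: lerD.
Qed.

Theorem theorem3p2 (R : realType) (n m : nat)
    (c : 'rV[R]_n -> 'rV[R]_m) (g : 'rV[R]_m -> \bar R)
    (F : 'rV[R]_n -> \bar R) (Mg : set 'rV[R]_m) (xbar : 'rV[R]_n)
    (hc : C2_on setT c) (hg : proper_efun g) (hlsc : lower_semicontinuous g)
    (hF : F = g \o c) (hq : qualified g c Mg xbar) :
  exists (V : set 'rV[R]_n) (Gamma cri cmap Ltilde : R),
    [/\ nbhs xbar V,
        [/\ 0 < Gamma, 0 < cri, 0 < cmap & 0 < Ltilde],
        forall x, V x ->
          0 <= phi_discr cri cmap Ltilde (dist_to (c @^-1` Mg) x) /\
          forall gamma : R, 0 < gamma ->
            phi cri cmap Ltilde (dist_to (c @^-1` Mg) x) <= gamma <= Gamma ->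
            prox_in gamma g (c x) Mg,
        phi cri cmap Ltilde =
          (fun t : R => cmap / cri * t
             + Ltilde * cmap ^+ 2 / cri ^+ 3 * t ^+ 2)
          +o_ (0 : R) (fun t : R => t ^+ 2)
      & exists L epsilon : R, [/\ 0 < L, 0 < epsilon &
          forall (x : 'rV[R]_n) (gamma : R), 0 < gamma ->
            enorm (x - xbar) <= epsilon ->
            L * enorm (x - xbar) <= gamma <= Gamma ->
            prox_in gamma g (c x) Mg]].
Proof.
case: hq => -[pb preg] ps _ [asc _].
have [kap [dt [kap0 dt0 key]]] := prox_manifold hg.1 pb preg ps asc.
have Mx : (c @^-1` Mg) xbar by case: ps => -[].
have [Lc [r [Lc0 r0 lip]]] := C1_lipschitz openT hc.1 (I : setT xbar).
have near0 : `|xbar - xbar| < r by rewrite subrr normr0.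
(* [K] is the value of c_map, the other two constants being 1. Its factor 2 leaves room for a point
   of the preimage that only nearly attains the distance. *)
pose K : R := 2 * Lc / kap.
have K0 : 0 < K by rewrite divr_gt0 // mulr_gt0.
have KE : Lc * (2 / K) = kap.
  by rewrite /K; field; rewrite !gt_eqF.
(* The second bound gives 2 gamma / K <= r / 2, which keeps that nearby point inside the Lipschitz
   ball of [c]. *)
pose Gam : R := Num.min dt (r * K / 4).
have Gam0 : 0 < Gam by rewrite lt_min dt0 divr_gt0 // mulr_gt0.
(* The last two bounds keep [c x] within [dt] of [c xbar] and the discriminant nonnegative. *)
have [rho [rho0 rho1 rho2 rho3]] : exists rho : R, [/\ 0 < rho, rho <= r / 2,
    Lc * rho <= dt & 4 * K * (n.+1%:R * rho) <= 1].
  exists (Num.min (r / 2) (Num.min (dt / Lc) (1 / (4 * K * n.+1%:R)))); split.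
  - rewrite !lt_min; apply/and3P; split; apply: divr_gt0 => //.
    by apply: mulr_gt0 => //; apply: mulr_gt0.
  - by rewrite ge_min lexx.
  - by rewrite mulrC -ler_pdivlMr // !ge_min lexx orbT.
  - rewrite mulrA [leLHS]mulrC -ler_pdivlMr; first by rewrite !ge_min lexx !orbT.
    by apply: mulr_gt0 => //; apply: mulr_gt0.
have cnear x : `|x - xbar| < rho -> `|x - xbar| < r /\ `|c x - c xbar| < dt.
  move=> xrho; have xr : `|x - xbar| < r by lra.
  split=> //; apply: le_lt_trans (norm_le_enorm _) _.
  apply: le_lt_trans (lip _ _ xr near0) _; apply: lt_le_trans rho2.
  by rewrite ltr_pM2l.
exists [set x | `|x - xbar| < rho], Gam, 1, K, 1; split.
- by apply/nbhs_rVP; exists rho.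
- by split.
- move=> x /= xrho; have [xr cx] := cnear x xrho.
  set t := dist_to _ x.
  have d0 : 0 <= phi_discr 1 K 1 t.
    have tx : t <= n.+1%:R * rho.
      apply: le_trans (dist_to_le x Mx) _; apply: le_trans (enorm_le_norm _) _.
      by rewrite ler_wpM2l // ltW.
    have K40 : 0 <= 4 * K by rewrite mulr_ge0 // ltW.
    rewrite /phi_discr expr1n divr1 mulr1 subr_ge0.
    exact: le_trans (ler_wpM2l K40 tx) rho3.
  split=> // gam gam0 /andP[ph]; rewrite le_min => /andP[gd gr].
  (* Strict even for t = 0, so a point of the preimage at distance below this bound exists. *)
  have tg : t < 2 / K * gam.
    have := le_trans (phi_ge d0) ph.
    rewrite mulrC -ler_pdivlMr // => /le_lt_trans; apply.
    have -> : 2 / K * gam = 2 * (gam / K) by rewrite mulrA mulrAC.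
    by rewrite ltr_pMl ?ltr1n // divr_gt0.
  have [z Mz xz] := dist_to_near (ex_intro _ _ Mx) tg.
  have zr : `|z - xbar| < r.
    have -> : z - xbar = (x - xbar) - (x - z) by rewrite opprB [RHS]addrC addrA subrK.
    apply: le_lt_trans (ler_normB _ _) _.
    have : 2 / K * gam <= r / 2.
      rewrite mulrAC ler_pdivrMr //; lra.
    have := le_lt_trans (norm_le_enorm _) xz.
    by move: xrho; move: (`|x - xbar|) (`|x - z|) (2 / K * gam) => *; lra.
  apply: (key (c x) (c z) gam cx gam0 gd Mz).
  apply: le_trans (lip _ _ xr zr) _; rewrite -KE -mulrA ler_pM2l //.
  exact: le_trans (norm_le_enorm _) (ltW xz).
- exact: phi_expansion.
(* Here [c xbar] itself serves as the nearby point of the manifold, so the distance and phi are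
   bypassed. *)
- exists (Lc / kap), (rho / 2); split; [by rewrite divr_gt0 | by rewrite divr_gt0 |].
  move=> x gam gam0 xe /andP[Lg]; rewrite le_min => /andP[gd _].
  have xrho : `|x - xbar| < rho.
    by have := le_trans (norm_le_enorm _) xe; move: (`|x - xbar|) => *; lra.
  have [xr cx] := cnear x xrho.
  apply: (key (c x) (c xbar) gam cx gam0 gd Mx).
  apply: le_trans (lip _ _ xr near0) _.
  rewrite [leRHS]mulrC -ler_pdivrMr //.
  apply: le_trans Lg; rewrite mulrAC.
  by rewrite ler_wpM2l ?norm_le_enorm // ltW // divr_gt0.
Qed.
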